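(* For every $n\ge 1$, the zero locus in $OG(n,2n+1)$ of a general global section of $\wedge^2\mathcal{U}^\vee$ is isomorphic to $(\mathbb{P}^1)^n$.
   Context: Over $\mathbb{C}$. $OG(n,2n+1)$ is the orthogonal Grassmannian of (maximal) isotropic $n$-dimensional subspaces of $\mathbb{C}^{2n+1}$ with a non-degenerate quadratic form, and $\mathcal{U}$ is its tautological bundle of rank $n$. A section of $\wedge^2\mathcal{U}^\vee$ is defined by a skew-symmetric bilinear form on $\mathbb{C}^{2n+1}$, and its zero locus parametrizes the $n$-dimensional subspaces that are isotropic for both forms. *)

(* Defs.v *)
From HB Require Import structures.
From mathcomp Require Import all_boot all_order all_algebra.
From mathcomp Require Import boolp reals complex mpoly.

Set Implicit Arguments.
Unset Strict Implicit.
Unset Printing Implicit Defensive.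

Import GRing.Theory.
Local Open Scope ring_scope.

(* Schemes over a field K are represented by their functors of points on
   commutative K-algebras, so that an isomorphism of K-schemes is a natural
   bijection (Yoneda).  A [comAlgType] is nonzero; the zero algebra carries no
   information, since every scheme has exactly one point over it. *)
Record functor_of_points (K : fieldType) := FunctorOfPoints {
  points :> comAlgType K -> Type;
  base_change : forall A B : comAlgType K,
    {lrmorphism A -> B} -> points A -> points B;
  base_change_id : forall (A : comAlgType K) (x : points A),
    base_change (idfun : {lrmorphism A -> A}) x = x;
  base_change_comp : forall (A B C : comAlgType K) (g : {lrmorphism B -> C})
    (f : {lrmorphism A -> B}) (x : points A),
    base_change (g \o f : {lrmorphism A -> C}) x
    = base_change g (base_change f x) }.

Arguments base_change {K} f {A B} g x : rename.

Definition isomorphic (K : fieldType) (X Y : functor_of_points K) : Prop :=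
  exists phi : forall A : comAlgType K, X A -> Y A,
    (forall A : comAlgType K, bijective (phi A)) /\
    (forall (A B : comAlgType K) (f : {lrmorphism A -> B}) (x : X A),
       phi B (base_change X f x) = base_change Y f (phi A x)).

Section Power.
Variables (K : fieldType) (X : functor_of_points K) (n : nat).

Definition power_base_change (A B : comAlgType K) (f : {lrmorphism A -> B})
  (x : 'I_n -> X A) : 'I_n -> X B := fun i => base_change X f (x i).

Lemma power_base_change_id (A : comAlgType K) (x : 'I_n -> X A) :
  power_base_change (idfun : {lrmorphism A -> A}) x = x.
Proof. by apply: funext => i; apply: base_change_id. Qed.

Lemma power_base_change_comp (A B C : comAlgType K) (g : {lrmorphism B -> C})
    (f : {lrmorphism A -> B}) (x : 'I_n -> X A) :
  power_base_change (g \o f : {lrmorphism A -> C}) x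
  = power_base_change g (power_base_change f x).
Proof. by apply: funext => i; apply: base_change_comp. Qed.

Definition power : functor_of_points K :=
  FunctorOfPoints power_base_change_id power_base_change_comp.

End Power.

Section Subfunctor.
Variables (K : fieldType) (X : functor_of_points K).
Variable P : forall A : comAlgType K, X A -> Prop.
Hypothesis P_stable : forall (A B : comAlgType K) (f : {lrmorphism A -> B})
  (x : X A), P x -> P (base_change X f x).

Definition subfunctor_base_change (A B : comAlgType K)
    (f : {lrmorphism A -> B}) (x : {x : X A | P x}) : {x : X B | P x} :=
  exist _ (base_change X f (sval x)) (P_stable f (svalP x)).

Lemma subfunctor_base_change_id (A : comAlgType K) (x : {x : X A | P x}) :
  subfunctor_base_change (idfun : {lrmorphism A -> A}) x = x.
Proof. by case: x => x Px; apply: eq_exist; apply: base_change_id. Qed.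

Lemma subfunctor_base_change_comp (A B C : comAlgType K)
    (g : {lrmorphism B -> C}) (f : {lrmorphism A -> B})
    (x : {x : X A | P x}) :
  subfunctor_base_change (g \o f : {lrmorphism A -> C}) x
  = subfunctor_base_change g (subfunctor_base_change f x).
Proof. by case: x => x Px; apply: eq_exist; apply: base_change_comp. Qed.

Definition subfunctor : functor_of_points K :=
  FunctorOfPoints subfunctor_base_change_id subfunctor_base_change_comp.

End Subfunctor.

(* L is a rank k subbundle of the trivial bundle A^m on Spec A: a direct
   summand of A^m (the image {v | v P = v} of a projector P) whose fibre at
   every point of Spec A has dimension k.  The points of Spec A are tested by
   the ring morphisms from A to fields. *)
Definition is_subbundle (k m : nat) (A : comNzRingType)
    (L : 'rV[A]_m -> Prop) : Prop :=
  exists P : 'M[A]_m,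
    [/\ P *m P = P,
        (forall v : 'rV[A]_m, L v <-> v *m P = v)
      & forall (F : fieldType) (h : {rmorphism A -> F}),
          \rank (map_mx h P) = k].

Record subbundle (k m : nat) (A : comNzRingType) := Subbundle {
  in_subbundle :> 'rV[A]_m -> Prop;
  subbundleP : is_subbundle k in_subbundle }.

Lemma subbundle_eq (k m : nat) (A : comNzRingType) (L L' : subbundle k m A) :
  (forall v : 'rV[A]_m, L v <-> L' v) -> L = L'.
Proof.
case: L L' => [L HL] [L' HL'] /= eqL.
have eqLL' : L = L' by apply: funext => v; apply: propext.
by case: _ / eqLL' HL' => HL'; congr Subbundle; apply: Prop_irrelevance.
Qed.

(* The B-submodule of B^m generated by f(L), i.e. the image of the pullback
   of L along Spec B -> Spec A. *)
Definition extend (m : nat) (A B : comNzRingType) (f : {rmorphism A -> B})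
    (L : 'rV[A]_m -> Prop) (w : 'rV[B]_m) : Prop :=
  exists (r : nat) (c : 'rV[B]_r) (M : 'M[A]_(r, m)),
    (forall i : 'I_r, L (row i M)) /\ w = c *m map_mx f M.

Section Extension.
Variables (k m : nat).

Lemma extend_projector (A B : comNzRingType) (f : {rmorphism A -> B})
    (L : 'rV[A]_m -> Prop) (P : 'M[A]_m) :
  P *m P = P -> (forall v : 'rV[A]_m, L v <-> v *m P = v) ->
  forall w : 'rV[B]_m, extend f L w <-> w *m map_mx f P = w.
Proof.
move=> PP LP w; split=> [[r [c [M [LM ->]]]]|wP].
  rewrite -mulmxA -map_mxM; congr (_ *m map_mx f _).
  by apply/row_matrixP => i; rewrite row_mul; apply/LP.
by exists m, w, P; split=> // i; apply/LP; rewrite -row_mul PP.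
Qed.

Lemma extend_subbundle (A B : comNzRingType) (f : {rmorphism A -> B})
    (L : subbundle k m A) : is_subbundle k (extend f L).
Proof.
case: (subbundleP L) => P [PP LP rkP]; exists (map_mx f P); split.
- by rewrite -map_mxM PP.
- exact: extend_projector.
- by move=> F h; rewrite -map_mx_comp; apply: (rkP F (h \o f)).
Qed.

Definition subbundle_base_change (A B : comNzRingType)
    (f : {rmorphism A -> B}) (L : subbundle k m A) : subbundle k m B :=
  Subbundle (extend_subbundle f L).

Lemma subbundle_base_change_id (A : comNzRingType) (L : subbundle k m A) :
  subbundle_base_change (idfun : {rmorphism A -> A}) L = L.
Proof.
apply: subbundle_eq => v; case: (subbundleP L) => P [PP LP _].
have /= -> := extend_projector idfun PP LP v.
by rewrite map_mx_id // LP.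
Qed.

Lemma subbundle_base_change_comp (A B C : comNzRingType)
    (g : {rmorphism B -> C}) (f : {rmorphism A -> B}) (L : subbundle k m A) :
  subbundle_base_change (g \o f : {rmorphism A -> C}) L
  = subbundle_base_change g (subbundle_base_change f L).
Proof.
apply: subbundle_eq => v; case: (subbundleP L) => P [PP LP _] /=.
rewrite (extend_projector (g \o f) PP LP) map_mx_comp.
rewrite (@extend_projector _ _ g _ (map_mx f P)) //.
  by rewrite -map_mxM PP.
exact: extend_projector.
Qed.

End Extension.

Definition Gr (K : fieldType) (k m : nat) : functor_of_points K :=
  @FunctorOfPoints K (fun A : comAlgType K => subbundle k m A)
    (fun A B (f : {lrmorphism A -> B}) => subbundle_base_change f)
    (fun A => @subbundle_base_change_id k m A)
    (fun A B C (g : {lrmorphism B -> C}) (f : {lrmorphism A -> B}) =>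
       subbundle_base_change_comp g f).

Definition P1 (K : fieldType) : functor_of_points K := Gr K 1 2.

(* The bilinear form on A^m with Gram matrix G. *)
Definition bilin (K : fieldType) (m : nat) (G : 'M[K]_m) (A : comAlgType K)
    (u v : 'rV[A]_m) : A :=
  (u *m map_mx (in_alg A) G *m v^T) 0 0.

Definition isotropic (K : fieldType) (m : nat) (G : 'M[K]_m)
    (A : comAlgType K) (L : 'rV[A]_m -> Prop) : Prop :=
  forall u v : 'rV[A]_m, L u -> L v -> bilin G u v = 0.

Lemma isotropic_extend (K : fieldType) (m : nat) (G : 'M[K]_m)
    (A B : comAlgType K) (f : {lrmorphism A -> B}) (L : 'rV[A]_m -> Prop) :
  isotropic G L -> isotropic G (extend f L).
Proof.
move=> isoL _ _ [r [c [M [LM ->]]]] [s [d [N [LN ->]]]].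
have -> : bilin G (c *m map_mx f M) (d *m map_mx f N)
  = (c *m map_mx f (M *m map_mx (in_alg A) G *m N^T) *m d^T) 0 0.
  have fG : map_mx f (map_mx (in_alg A) G) = map_mx (in_alg B) G.
    by apply/matrixP => i j; rewrite !mxE /= rmorph_alg.
  by rewrite /bilin !map_mxM fG trmx_mul map_trmx !mulmxA.
suff -> : M *m map_mx (in_alg A) G *m N^T = 0.
  by rewrite map_mx0 mulmx0 mul0mx mxE.
apply/matrixP => i j; rewrite [RHS]mxE -(isoL _ _ (LM i) (LN j)) /bilin.
rewrite -row_mul !mxE; apply: eq_bigr => l _.
by rewrite !mxE.
Qed.

(* Q is the Gram matrix of a quadratic form q; over an algebra in which 2 is
   invertible, q vanishes on a submodule iff its polar form does. *)
Definition OG (K : fieldType) (n : nat) (Q : 'M[K]_(2 * n + 1)) :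
    functor_of_points K :=
  @subfunctor K (Gr K n (2 * n + 1))
    (fun (A : comAlgType K) (L : subbundle n (2 * n + 1) A) => isotropic Q L)
    (fun A B f L => @isotropic_extend K _ Q A B f L).

(* A form w with values in K defines the section L |-> w|_L of the second
   exterior power of the dual tautological bundle; it vanishes at L exactly
   when L is isotropic for w. *)
Definition zero_locus (K : fieldType) (n : nat) (Q w : 'M[K]_(2 * n + 1)) :
    functor_of_points K :=
  @subfunctor K (OG Q)
    (fun (A : comAlgType K) (L : OG Q A) => isotropic w (sval L))
    (fun A B f L => @isotropic_extend K _ w A B f (sval L)).

(* Over a field of characteristic different from 2 these are the alternating
   forms. *)
Definition skew (K : fieldType) (m : nat) (w : 'M[K]_m) : Prop := w^T = - w.

Definition mxeval (K : fieldType) (m : nat) (F : {mpoly K[m * m]})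
    (w : 'M[K]_m) : K := F.@[fun i => mxvec w 0 i].

(* P holds on a nonempty Zariski open subset of the affine space of skew
   matrices, namely the complement of the common zeros of a set I of
   polynomials in the matrix entries. *)
Definition for_general_skew (K : fieldType) (m : nat) (P : 'M[K]_m -> Prop) :
    Prop :=
  exists I : {mpoly K[m * m]} -> Prop,
    let U := fun w : 'M[K]_m =>
      skew w /\ (exists F : {mpoly K[m * m]}, I F /\ mxeval F w <> 0) in
    (exists w : 'M[K]_m, U w) /\ (forall w : 'M[K]_m, U w -> P w).

(* Main.v *)
(* For general w the operator w Q^-1 is diagonalisable with distinct
   eigenvalues 0, lam_k, - lam_k, which yields a basis e_k, f_k, e in which
   Q(e_k, f_k) = Q(e, e) = 1, w(e_k, f_k) = lam_k and all other products vanish.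
   The n-planes isotropic for both forms and complementary to <e, f_1, ..., f_n>
   are then the spans of
     e_k + a_k e - \sum_j lam_k / (lam_k + lam_j) a_k a_j f_j
   with (a_1, ..., a_n) arbitrary.  Exchanging e_k and f_k for k in a set J gives
   2 ^ n such charts; they cover the zero locus, because over a field a J for
   which the projection to the chart coordinates has maximal rank works.
   Exchanging e_i and f_i replaces a_i by - 2 / a_i and a_k by
   (lam_i - lam_k) / (lam_i + lam_k) a_k: up to rescaling the coordinates by
   constants, this is the gluing of the standard charts of (P^1)^n.
   On points over an arbitrary algebra A the correspondence is defined over all
   local rings B over A.  It descends to A because solvability of linear systems
   can be tested on localisations, and the existence of a projector onto the span
   of given vectors is such a system. *)
Require Import Defs.
From HB Require Import structures.
From mathcomp Require Import all_boot all_order all_algebra.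
From mathcomp Require Import boolp reals complex mpoly.
From mathcomp Require Import all_field generic_quotient ring_quotient ring zify.
From mathcomp Require classical_sets.

Set Implicit Arguments.
Unset Strict Implicit.
Unset Printing Implicit Defensive.

Import GRing.Theory Num.Theory.
Local Open Scope ring_scope.

(** * Localisation and residue fields *)

(** Local rings rather than fields are the test objects: morphisms to fields do not see nilpotents,
    whereas an element that vanishes in every localisation at a prime is 0, and a minor that is
    nonzero in the residue field is already invertible. Since no chart is preferred, the
    correspondence is a relation between planes and n-tuples of lines. Uniqueness in both directions
    comes from rewriting two charts as one: the parameters at which they differ are units as soon as
    the planes, or the lines, agree. Existence over [A] is proved separately in each direction, from
    homogeneous coordinates that need no division. The eigenvalue 0 and the pairs lam_k, - lam_k
    come from w Q^-1 being skew for Q in odd dimension. That distinct eigenvalues do occur is shown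
    on one explicit pair of forms: over an algebraically closed field of characteristic 0 all
    non-degenerate Q are congruent. *)

Record mulset (A : comNzRingType) := Mulset {
  in_mulset :> A -> Prop;
  mulset1 : in_mulset 1;
  mulsetM : forall s t, in_mulset s -> in_mulset t -> in_mulset (s * t);
  mulset0 : ~ in_mulset 0 }.

Module Localization.
Section Localization.
Local Open Scope quotient_scope.
Variables (A : comNzRingType) (S : mulset A).

Definition frac := (A * {s : A | `[< S s >]})%type.
Implicit Types x y z : frac.
Definition den x : A := val x.2.
Lemma denP x : S (den x). Proof. exact/asboolP/(valP x.2). Qed.
Definition mk (a s : A) (Ss : S s) : frac := (a, Sub s (asboolT Ss)).

(** The factor [u] keeps the relation transitive in the presence of zero divisors. *)
Definition equivf x y : bool :=
  `[< exists2 u, S u & u * (x.1 * den y) = u * (y.1 * den x) >].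
Lemma equivf_refl : reflexive equivf.
Proof. by move=> x; apply/asboolP; exists 1 => //; apply: mulset1. Qed.
Lemma equivf_sym : ssrbool.symmetric equivf.
Proof. by move=> x y; apply: asbool_equiv_eq; split => -[u Su E]; exists u. Qed.
Lemma equivf_trans : transitive equivf.
Proof.
move=> y x z /asboolP[u Su E] /asboolP[v Sv E']; apply/asboolP.
exists (u * v * den y); first by do !apply: mulsetM => //; apply: denP.
transitivity (v * den z * (u * (x.1 * den y))); first by ring.
rewrite E; transitivity (u * den x * (v * (y.1 * den z))); first by ring.
by rewrite E'; ring.
Qed.
Canonical equivf_equiv := EquivRel equivf equivf_refl equivf_sym equivf_trans.

Definition type := {eq_quot equivf}.
HB.instance Definition _ : EqQuotient _ equivf type := EqQuotient.on type.
HB.instance Definition _ := Choice.on type.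

Lemma pi_eq x y : (exists2 u, S u & u * (x.1 * den y) = u * (y.1 * den x)) <->
  \pi_type x = \pi_type y.
Proof.
by split=> [h|/eqmodP /asboolP //]; apply/eqmodP/asboolP.
Qed.

Lemma repr_pi x : exists2 u, S u &
  u * ((repr (\pi_type x)).1 * den x) = u * (x.1 * den (repr (\pi_type x))).
Proof. by apply/pi_eq; rewrite reprK. Qed.

Definition addf x y : frac :=
  mk (x.1 * den y + y.1 * den x) (mulsetM (denP x) (denP y)).
Definition add := lift_op2 type addf.
Lemma pi_add : {morph \pi : x y / addf x y >-> add x y}.
Proof.
move=> x y; unlock add; apply/pi_eq; rewrite /addf /den /= -!/(den _).
have [u Su E] := repr_pi x; have [v Sv E'] := repr_pi y.
exists (u * v); first exact: mulsetM.
set x' := repr _ in E *; set y' := repr _ in E' *.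
transitivity (v * den y * den y' * (u * (x.1 * den x'))
  + u * den x * den x' * (v * (y.1 * den y'))); first by ring.
by rewrite -E -E'; ring.
Qed.
Canonical pi_add_morph := PiMorph2 pi_add.

Definition oppf x : frac := (- x.1, x.2).
Definition opp := lift_op1 type oppf.
Lemma pi_opp : {morph \pi : x / oppf x >-> opp x}.
Proof.
move=> x; unlock opp; apply/pi_eq; rewrite /oppf /den /= -!/(den _).
by have [u Su E] := repr_pi x; exists u; rewrite // !mulNr !mulrN E.
Qed.
Canonical pi_opp_morph := PiMorph1 pi_opp.

Definition mulf x y : frac := mk (x.1 * y.1) (mulsetM (denP x) (denP y)).
Definition mul := lift_op2 type mulf.
Lemma pi_mul : {morph \pi : x y / mulf x y >-> mul x y}.
Proof.
move=> x y; unlock mul; apply/pi_eq; rewrite /mulf /den /= -!/(den _).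
have [u Su E] := repr_pi x; have [v Sv E'] := repr_pi y.
exists (u * v); first exact: mulsetM.
set x' := repr _ in E *; set y' := repr _ in E' *.
transitivity ((u * (x.1 * den x')) * (v * (y.1 * den y'))); first by ring.
by rewrite -E -E'; ring.
Qed.
Canonical pi_mul_morph := PiMorph2 pi_mul.

Definition inj := lift_embed type (fun a : A => mk a (mulset1 S)).
Canonical inj_pi_morph := PiEmbed inj.

Lemma addA : associative add.
Proof.
elim/quotW=> x; elim/quotW=> y; elim/quotW=> z; rewrite !piE.
apply/pi_eq; exists 1; first exact: mulset1.
by rewrite /addf /den /= -!/(den _); ring.
Qed.
Lemma addC : commutative add.
Proof.
elim/quotW=> x; elim/quotW=> y; rewrite !piE.
apply/pi_eq; exists 1; first exact: mulset1.
by rewrite /addf /den /= -!/(den _); ring.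
Qed.
Lemma add0 : left_id (inj 0) add.
Proof.
elim/quotW=> x; rewrite !piE.
apply/pi_eq; exists 1; first exact: mulset1.
by rewrite /addf /den /= -!/(den _); ring.
Qed.
Lemma addN : left_inverse (inj 0) opp add.
Proof.
elim/quotW=> x; rewrite !piE.
apply/pi_eq; exists 1; first exact: mulset1.
by rewrite /addf /den /= -!/(den _); ring.
Qed.
HB.instance Definition _ := GRing.isZmodule.Build type addA addC add0 addN.

Lemma mulA : associative mul.
Proof.
elim/quotW=> x; elim/quotW=> y; elim/quotW=> z; rewrite !piE.
apply/pi_eq; exists 1; first exact: mulset1.
by rewrite /mulf /den /= -!/(den _); ring.
Qed.
Lemma mulC : commutative mul.
Proof.
elim/quotW=> x; elim/quotW=> y; rewrite !piE.
apply/pi_eq; exists 1; first exact: mulset1.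
by rewrite /mulf /den /= -!/(den _); ring.
Qed.
Lemma mul1 : left_id (inj 1) mul.
Proof.
elim/quotW=> x; rewrite !piE.
apply/pi_eq; exists 1; first exact: mulset1.
by rewrite /mulf /den /= -!/(den _); ring.
Qed.
Lemma mulD : left_distributive mul add.
Proof.
elim/quotW=> x; elim/quotW=> y; elim/quotW=> z; rewrite !piE.
apply/pi_eq; exists 1; first exact: mulset1.
by rewrite /mulf /addf /den /= -!/(den _); ring.
Qed.
Lemma nonzero1 : inj 1 != inj 0.
Proof.
apply/eqP; rewrite !piE => /pi_eq[u Su]; rewrite /den /= !mul0r !mulr0 !mulr1.
by move=> u0; apply: (@mulset0 _ S); rewrite -u0.
Qed.
HB.instance Definition _ :=
  GRing.Zmodule_isComNzRing.Build type mulA mulC mul1 mulD nonzero1.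

Lemma inj_zmod : zmod_morphism (inj : A -> type).
Proof.
move=> a b; unlock inj; rewrite -[X in _ = _ + X]pi_opp -[RHS]pi_add.
apply/pi_eq; exists 1; first exact: mulset1.
by rewrite /addf /oppf /den /= -!/(den _); ring.
Qed.
HB.instance Definition _ := GRing.isZmodMorphism.Build A type inj inj_zmod.
Lemma inj_monoid : monoid_morphism (inj : A -> type).
Proof.
split=> [//|a b]; unlock inj; rewrite -[RHS]pi_mul.
apply/pi_eq; exists 1; first exact: mulset1.
by rewrite /mulf /den /= -!/(den _); ring.
Qed.
HB.instance Definition _ := GRing.isMonoidMorphism.Build A type inj inj_monoid.

Lemma inj_eq0 a : inj a = 0 -> exists2 u, S u & u * a = 0.
Proof.
rewrite -[0]/(inj 0) !piE => /pi_eq[u Su]; rewrite /den /= mulr1 mul0r mulr0.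
by exists u.
Qed.
Lemma inj_unit s : S s -> exists y : type, inj s * y = 1.
Proof.
move=> Ss; exists (\pi_type (mk 1 Ss)); rewrite -[RHS]/(inj 1).
rewrite -[LHS]/(mul _ _) !piE.
apply/pi_eq; exists 1; first exact: mulset1.
by rewrite /den /= /den /=; ring.
Qed.
Lemma inj_surj (y : type) : exists a s, S s /\ inj s * y = inj a.
Proof.
elim/quotW: y => x; exists x.1, (den x); split; first exact: denP.
rewrite -[LHS]/(mul _ _) !piE.
apply/pi_eq; exists 1; first exact: mulset1.
by rewrite /den /= /den /=; ring.
Qed.
End Localization.
End Localization.
HB.export Localization.

Definition invertible (A : comNzRingType) (x : A) : Prop :=
  exists y, x * y = 1.

Lemma invertible1 (A : comNzRingType) : invertible (1 : A).
Proof. by exists 1; rewrite mulr1. Qed.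

Lemma invertibleM (A : comNzRingType) (x y : A) :
  invertible (x * y) <-> invertible x /\ invertible y.
Proof.
split=> [[z xyz]|[[x' xx'] [y' yy']]]; last first.
  by exists (x' * y'); rewrite mulrACA xx' yy' mulr1.
by split; [exists (y * z) | exists (x * z)]; rewrite -xyz; ring.
Qed.

Lemma invertible_morph (A B : comNzRingType) (f : {rmorphism A -> B}) x :
  invertible x -> invertible (f x).
Proof. by case=> y xy; exists (f y); rewrite -rmorphM xy rmorph1. Qed.

Lemma invertible_field (F : fieldType) (x : F) : invertible x <-> x != 0.
Proof.
split=> [[y xy]|x0]; last by exists x^-1; rewrite mulfV.
by apply/eqP => x0; move/eqP: xy; rewrite x0 mul0r eq_sym oner_eq0.
Qed.

(** For a nonzero ring this says that the non-units form an ideal, which is then the unique maximal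
    one. *)
Definition local_ring (A : comNzRingType) : Prop :=
  forall x : A, invertible x \/ invertible (1 - x).

Lemma field_local (F : fieldType) : local_ring F.
Proof.
move=> x; rewrite !invertible_field; have [->|] := eqVneq x 0; last by left.
by right; rewrite subr0 oner_neq0.
Qed.

Record local_comRing := LocalComRing {
  local_sort : comNzRingType;
  local_sortP : local_ring local_sort }.

Module ResidueField.
Section ResidueField.
Variable B : local_comRing.
Local Notation A := (local_sort B).

Definition nonunit (x : A) : bool := ~~ `[< invertible x >].
Lemma nonunit_idealr : idealr_closed (nonunit : {pred A}).
Proof.
have I0 : ~ invertible (0 : A).
  by case=> y /eqP; rewrite mul0r eq_sym oner_eq0.
split; first exact/asboolPn.
  by rewrite unfold_in negbK; apply/asboolP/invertible1.
move=> a u v /asboolPn Nu /asboolPn Nv; apply/asboolPn => -[y uvy].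
(* The elements [a * u * y] and [v * y] add up to 1, so one of them is invertible. *)
have [] := local_sortP (a * u * y).
  by rewrite -mulrA mulrCA => /invertibleM[].
have -> : 1 - a * u * y = v * y by rewrite -uvy; ring.
by case/invertibleM.
Qed.
HB.instance Definition _ := isIdealr.Build A nonunit nonunit_idealr.

Definition type := {ideal_quot (nonunit : idealr A)}.
HB.instance Definition _ := GRing.ComNzRing.on type.
Definition proj (x : A) : type := (\pi_{ideal_quot (nonunit : idealr A)} x)%qT.
Lemma proj_zmod : zmod_morphism proj.
Proof. by move=> x y; rewrite /proj !piE. Qed.
HB.instance Definition _ := GRing.isZmodMorphism.Build A type proj proj_zmod.
Lemma proj_monoid : monoid_morphism proj.
Proof. by split=> [|x y]; rewrite /proj !piE. Qed.
HB.instance Definition _ :=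
  GRing.isMonoidMorphism.Build A type proj proj_monoid.

Lemma proj_eq0 x : proj x = 0 <-> ~ invertible x.
Proof.
rewrite -(rmorph0 proj); split=> [/eqP|Nx]; last apply/eqP;
  rewrite -Quotient.idealrBE subr0.
  by move/asboolPn.
exact/asboolPn.
Qed.

(** An inverse is chosen classically; the default 0 serves the convention that 0 is its own
    inverse. *)
Definition inv (x : type) : type :=
  if pselect (exists y, x * y = 1) is left h then projT1 (cid h) else 0.
Lemma invP (x : type) : x != 0 -> inv x * x = 1.
Proof.
move=> x0; rewrite /inv; case: pselect => [h|[]].
  by rewrite mulrC (projT2 (cid h)).
have px : proj (repr x) = x by apply: reprK.
have /contrapT [y ry] : ~ ~ invertible (repr x).
  by move/proj_eq0; rewrite px; apply/eqP.
by exists (proj y); rewrite -{1}px -rmorphM ry rmorph1.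
Qed.
Lemma inv0 : inv 0 = 0.
Proof.
rewrite /inv; case: pselect => // -[y yx]; exfalso; move/eqP: yx.
by rewrite mul0r eq_sym oner_eq0.
Qed.
HB.instance Definition _ := GRing.ComNzRing_isField.Build type invP inv0.
End ResidueField.
End ResidueField.
HB.export ResidueField.

Lemma residue_field (A : comNzRingType) : local_ring A ->
  exists (F : fieldType) (h : {rmorphism A -> F}),
    forall x, h x = 0 <-> ~ invertible x.
Proof.
move=> locA; exists (ResidueField.type (LocalComRing locA)).
exists (@ResidueField.proj (LocalComRing locA)).
exact: (@ResidueField.proj_eq0 (LocalComRing locA)).
Qed.

(** * Prime ideals avoiding the powers of an element *)

Section Prime.
Variables (A : comNzRingType) (J : A -> Prop) (s : A).
Hypotheses (J0 : J 0) (JD : forall a x y, J x -> J y -> J (a * x + y))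
  (JX : forall k, ~ J (s ^+ k)).

(** An ideal maximal among those that contain [J] and no power of [s] is prime. It is returned
    through its complement [S]; the last clause, additivity of the prime, is what makes the
    localisation local. *)
Lemma exists_prime : exists S : mulset A,
  [/\ S s, forall x, J x -> ~ S x & forall x y, ~ S x -> ~ S y -> ~ S (x + y)].
Proof.
(* The union of the empty chain is empty, so [P] must admit the empty set: [J] is required to lie in
   [X] only once [X] has an element. *)
pose P (X : A -> Prop) := [/\ forall a x y, X x -> X y -> X (a * x + y),
  forall x y, X x -> J y -> X y & forall k, ~ X (s ^+ k)].
have [F FP totF|M [[MD MJ MX] maxM]] := @classical_sets.Zorn_bigcup A P.
  split=> [a x y [X FX Xx] [Y FY Yy]|x y [X FX Xx] Jy|k [X FX]].
  - have [XY|YX] := totF _ _ FX FY.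
      by exists Y => //; have [+ _ _] := FP _ FY; apply => //; apply: XY.
    by exists X => //; have [+ _ _] := FP _ FX; apply => //; apply: YX.
  - by exists X => //; have [_ XJ _] := FP _ FX; apply: (XJ x).
  - by have [_ _] := FP _ FX; apply.
have JM : forall x, J x -> M x.
  have [[x Mx]|Mn] := pselect (exists x, M x); first by move=> y; apply: (MJ x).
  exfalso; apply: (maxM J); last by split.
  split; first by move=> x Mx; exfalso; apply: Mn; exists x.
  by move/(_ 0 J0) => M0; apply: Mn; exists 0.
have M0 := JM _ J0.
have MM a x : M x -> M (a * x) by move=> Mx; rewrite -[_ * _]addr0; apply: MD.
(* Otherwise the ideal generated by [M] and [t] would contradict maximality. *)
have ext t : ~ M t -> exists k a x, M x /\ s ^+ k = a * t + x.
  move=> Mt; apply: contrapT => no.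
  apply: (maxM (fun y => exists a x, M x /\ y = a * t + x)).
    split; first by move=> x Mx; exists 0, x; rewrite mul0r add0r.
    by move=> sub; apply/Mt/sub; exists 1, 0; rewrite mul1r addr0.
  split.
  - move=> a _ _ [b [x [Mx ->]]] [c [y [My ->]]].
    by exists (a * b + c), (a * x + y); split; [exact: MD|ring].
  - by move=> _ y _ Jy; exists 0, y; split; [exact: JM|ring].
  - by move=> k [a [x [Mx E]]]; apply: no; exists k, a, x.
have M1 : ~ M 1 by have := MX 0; rewrite expr0.
have MP x y : ~ M x -> ~ M y -> ~ M (x * y).
  move=> /ext[k [a [u [Mu Eu]]]] /ext[l [b [v [Mv Ev]]]] Mxy.
  apply: (MX (k + l)%N); rewrite exprD Eu Ev.
  have -> : (a * x + u) * (b * y + v)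
    = (a * b) * (x * y) + ((a * x + u) * v + (b * y) * u) by ring.
  by apply: (MD) => //; apply: (MD) => //; apply: MM.
exists (@Mulset A (fun x => ~ M x) M1 MP (fun h => h M0)); split=> /=.
- by have := MX 1%N; rewrite expr1.
- by move=> x /JM Mx; apply.
by move=> x y /contrapT Mx /contrapT My; apply; rewrite -[x]mul1r; apply: MD.
Qed.

End Prime.

(** If the numerator of y = a / s lies outside [S], then [s - a] lies in [S], since otherwise the
    sum [s] would lie outside. *)
Lemma localize (A : comNzRingType) (S : mulset A) :
  (forall x y, ~ S x -> ~ S y -> ~ S (x + y)) ->
  local_ring (Localization.type S).
Proof.
move=> SD y; have [a [s [Ss Ey]]] := Localization.inj_surj y.
have [Sa|NSa] := pselect (S a).
  have := Localization.inj_unit Sa; rewrite -Ey => h; left.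
  by have /invertibleM[] : invertible (Localization.inj S s * y) by [].
right; suff /invertibleM[] : invertible (Localization.inj S s * (1 - y)) by [].
rewrite mulrBr mulr1 Ey -rmorphB; apply: Localization.inj_unit.
apply: contrapT => NSsa; apply: (SD _ _ NSa NSsa).
by rewrite addrC subrK.
Qed.

(** * Descent from local rings *)

Lemma mulset_prod (A : comNzRingType) (S : mulset A) (I : finType) (s : I -> A) :
  (forall i, S (s i)) -> S (\prod_i s i).
Proof.
by move=> Ss; elim/big_ind: _ => //; [apply: mulset1 | apply: mulsetM].
Qed.

(* The d for which d * b is a combination of the C i form an ideal.  If it
   contained no power of s, it would lie in a prime avoiding s, against
   solvability over the localisation there. *)
Lemma local_solve (A : comNzRingType) (I T : finType) (C : I -> T -> A)
    (b : T -> A) (s : A) :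
  (forall (B : comNzRingType) (f : {rmorphism A -> B}), local_ring B ->
    invertible (f s) ->
    exists c : I -> B, forall q, f (b q) = \sum_i c i * f (C i q)) ->
  exists k (c : I -> A), forall q, s ^+ k * b q = \sum_i c i * C i q.
Proof.
move=> loc.
pose J d := exists c : I -> A, forall q, d * b q = \sum_i c i * C i q.
apply: contrapT => no.
have J0 : J 0.
  by exists (fun=> 0) => q; rewrite mul0r big1 // => i _; rewrite mul0r.
have JD a x y : J x -> J y -> J (a * x + y).
  move=> [c Ec] [d Ed]; exists (fun i => a * c i + d i) => q.
  rewrite mulrDl -mulrA Ec Ed mulr_sumr -big_split; apply: eq_bigr => i _ /=.
  by rewrite mulrDl mulrA.
have JX k : ~ J (s ^+ k) by move=> [c Ec]; apply: no; exists k, c.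
have [S [Ss JS SD]] := exists_prime J0 JD JX.
pose f : {rmorphism A -> Localization.type S} := @Localization.inj A S.
have [c Ec] := loc _ f (localize SD) (Localization.inj_unit Ss).
have [n nP] := choice (fun i => Localization.inj_surj (c i)).
have [d dP] := choice nP.
(* [t] is a common denominator of the coefficients [c i], and the [a i] are their numerators over
   it. *)
pose t := \prod_i d i.
pose a i := n i * \prod_(j | j != i) d j.
have ta i : f t * c i = f (a i).
  have [_ E] := dP i.
  rewrite /t /a (bigD1 i) //= !rmorphM mulrAC; congr (_ * _).
  exact: E.
have /choice[u uP] q : exists u, S u /\ u * (t * b q - \sum_i a i * C i q) = 0.
  have [|u Su u0] := @Localization.inj_eq0 A S (t * b q - \sum_i a i * C i q).
    rewrite -/(f _) rmorphB rmorphM Ec mulr_sumr rmorph_sum /=.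
    rewrite -sumrB big1 // => i _.
    by rewrite rmorphM -ta mulrA subrr.
  by exists u.
(* This element of [S] lies in [J]: after multiplication by the [u q], the identities of the
   localisation hold in [A]. *)
apply: (JS (\prod_q u q * t)); last first.
  by apply: mulsetM; apply: mulset_prod => x; [have [] := uP x | have [] := dP x].
exists (fun i => \prod_q u q * a i) => q.
have [_ /eqP] := uP q; rewrite mulrBr subr_eq0 => /eqP E.
rewrite (bigD1 q) //= -mulrA.
transitivity ((\prod_(i | i != q) u i) * (u q * (t * b q))); first by ring.
rewrite E !mulr_sumr; apply: eq_bigr => i _; ring.
Qed.

(** This is [local_solve] for the system without unknowns whose only equation is x - y = 0. *)
Lemma local_eq (A : comNzRingType) (x y : A) :
  (forall (B : comNzRingType) (f : {rmorphism A -> B}), local_ring B ->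
    f x = f y) -> x = y.
Proof.
move=> loc.
have [|k [c Ec]] := @local_solve A 'I_0 unit (fun _ _ => 0) (fun=> x - y) 1.
  move=> B f locB _; exists (fun=> 0) => _.
  by rewrite rmorphB loc // subrr big_ord0.
have := Ec tt; rewrite big_ord0 expr1n mul1r => /eqP.
by rewrite subr_eq0 => /eqP.
Qed.

Definition row_span (A : comNzRingType) (p m : nat) (M : 'M[A]_(p, m))
  (v : 'rV[A]_m) : Prop := exists c : 'rV[A]_p, v = c *m M.

Lemma row_span_row (A : comNzRingType) p m (M : 'M[A]_(p, m)) i :
  row_span M (row i M).
Proof. by exists (delta_mx 0 i); rewrite rowE. Qed.

Lemma row_spanP (A : comNzRingType) p q m (M : 'M[A]_(p, m)) (N : 'M[A]_(q, m)) :
  (forall i, row_span N (row i M)) <-> exists D, M = D *m N.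
Proof.
split=> [/choice[c cP]|[D ->] i]; last by exists (row i D); rewrite row_mul.
exists (\matrix_i c i); apply/row_matrixP => i.
by rewrite row_mul rowK cP.
Qed.

Lemma row_span_sub (A : comNzRingType) p q m (M : 'M[A]_(p, m))
    (N : 'M[A]_(q, m)) D v :
  M = D *m N -> row_span M v -> row_span N v.
Proof. by move=> -> [c ->]; exists (c *m D); rewrite mulmxA. Qed.

(** The right inverse [C] makes [C *m Y] a projector onto the row span. *)
Lemma span_subbundle (A : comNzRingType) k m (Y : 'M[A]_(k, m)) C :
  Y *m C = 1%:M -> is_subbundle k (row_span Y).
Proof.
move=> YC; exists (C *m Y); split.
- by rewrite mulmxA -(mulmxA C) YC mulmx1.
- move=> v; split=> [[c ->]|<-]; last by exists (v *m C); rewrite mulmxA.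
  by rewrite mulmxA -(mulmxA c) YC mulmx1.
move=> F h; rewrite map_mxM; apply/eqP; rewrite eqn_leq; apply/andP; split.
  by apply: leq_trans (mxrankM_maxr _ _) (rank_leq_row _).
apply: (@leq_trans (\rank (map_mx h (Y *m (C *m Y *m C))))).
  by rewrite -(mulmxA C) YC mulmx1 YC map_mx1 mxrank1.
rewrite !map_mxM; apply: leq_trans (mxrankM_maxr _ _) (mxrankM_maxl _ _).
Qed.

Lemma is_subbundle_ext (A : comNzRingType) k m (L L' : 'rV[A]_m -> Prop) :
  (forall v, L v <-> L' v) -> is_subbundle k L -> is_subbundle k L'.
Proof.
move=> LL' [P [PP LP rk]]; exists P; split=> // v; rewrite -LL'; exact: LP.
Qed.

Lemma mx_unit_of_det (A : comNzRingType) k (M : 'M[A]_k) :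
  invertible (\det M) -> exists N, N *m M = 1%:M /\ M *m N = 1%:M.
Proof.
case=> d Md; exists (d *: \adj M).
rewrite -scalemxAl -scalemxAr mul_mx_adj mul_adj_mx.
by rewrite scale_scalar_mx mulrC Md.
Qed.

(* Modulo the maximal ideal 1 - e is the identity, hence it is invertible. *)
Lemma local_idem0 (B : comNzRingType) m (e : 'M[B]_m) : local_ring B ->
  e *m e = e ->
  (forall (F : fieldType) (h : {rmorphism B -> F}), map_mx h e = 0) -> e = 0.
Proof.
move=> locB ee e0; have [F [h hP]] := residue_field locB.
have [|N [_ eN]] := @mx_unit_of_det B m (1%:M - e).
  apply: contrapT => /hP /eqP.
  by rewrite -det_map_mx map_mxB map_mx1 e0 subr0 det1 oner_eq0.
by rewrite -[e]mulmx1 -eN mulmxA mulmxBr mulmx1 ee subrr mul0mx.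
Qed.

(** A free summand of rank k inside a subbundle of rank k fills it: the idempotent [P - P *m C *m Y]
    vanishes over every field by comparison of ranks, so [local_idem0] applies. *)
Lemma local_span (B : comNzRingType) k m (L : 'rV[B]_m -> Prop)
    (Y : 'M[B]_(k, m)) C :
  local_ring B -> is_subbundle k L -> (forall i, L (row i Y)) ->
  Y *m C = 1%:M -> forall v, L v <-> row_span Y v.
Proof.
move=> locB [P [PP LP rk]] LY YC.
have YP : Y *m P = Y.
  by apply/row_matrixP => i; rewrite row_mul; apply/LP.
have PY : P = P *m C *m Y.
  have PX : P *m (P *m C *m Y) = P *m C *m Y by rewrite !mulmxA PP.
  have XP : P *m C *m Y *m P = P *m C *m Y by rewrite -mulmxA YP.
  have XX : P *m C *m Y *m (P *m C *m Y) = P *m C *m Y.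
    by rewrite !mulmxA XP -[X in X *m Y]mulmxA YC mulmx1.
  apply/eqP; rewrite -subr_eq0; apply/eqP; apply: local_idem0 => //.
    by rewrite mulmxBl !mulmxBr PP PX XP XX subrr subr0.
  move=> F h; apply/eqP; rewrite map_mxB subr_eq0; apply/eqP.
  have hYP : (map_mx h Y <= map_mx h P)%MS.
    by apply/submxP; exists (map_mx h Y); rewrite -map_mxM YP.
  have hYC : map_mx h Y *m map_mx h C = 1%:M by rewrite -map_mxM YC map_mx1.
  have rkY : \rank (map_mx h Y) = k.
    apply/eqP; rewrite eqn_leq rank_leq_row /=.
    by rewrite -{1}(mxrank1 F k) -hYC mxrankM_maxl.
  have /submxP[D PD] : (map_mx h P <= map_mx h Y)%MS.
    by rewrite -(geq_leqif (mxrank_leqif_sup hYP)) rk rkY.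
  by rewrite !map_mxM PD -!mulmxA [map_mx h Y *m _]mulmxA hYC mul1mx.
move=> v; split=> [/LP vP|[c ->]].
  by exists (v *m P *m C); rewrite -!mulmxA [P *m _]mulmxA -PY vP.
by apply/LP; rewrite -mulmxA YP.
Qed.

Lemma extend_comp k m (A B C : comNzRingType) (g : {rmorphism B -> C})
    (f : {rmorphism A -> B}) (L : subbundle k m A) w :
  extend (g \o f) L w <-> extend g (extend f L) w.
Proof.
by have /(congr1 (fun L : subbundle k m C => in_subbundle L w)) /= -> :=
  subbundle_base_change_comp g f L.
Qed.

Lemma extend_in (A B : comNzRingType) (f : {rmorphism A -> B}) m
    (L : 'rV[A]_m -> Prop) v : L v -> extend f L (map_mx f v).
Proof.
move=> Lv; exists 1%N, 1%:M, v; rewrite mul1mx; split=> // i.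
by rewrite ord1 row_id.
Qed.

Lemma subbundle_local_sub k m (A : comNzRingType) (L L' : subbundle k m A) :
  (forall (B : comNzRingType) (f : {rmorphism A -> B}), local_ring B ->
     forall v, extend f L v -> extend f L' v) ->
  forall v, L v -> L' v.
Proof.
move=> loc v Lv; case: (subbundleP L') => P' [PP' LP' _].
apply/LP'/rowP => j; apply: local_eq => B f locB.
have /(extend_projector f PP' LP') E := loc B f locB _ (extend_in f Lv).
by move/rowP/(_ j): E; rewrite -map_mxM !mxE.
Qed.

Lemma subbundle_local_eq k m (A : comNzRingType) (L L' : subbundle k m A) :
  (forall (B : comNzRingType) (f : {rmorphism A -> B}), local_ring B ->
     forall v, extend f L v <-> extend f L' v) -> L = L'.
Proof.
move=> loc; apply: subbundle_eq => v; split; apply: subbundle_local_sub => B f lB w;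
  by move/(loc B f lB w).
Qed.

Lemma uniform_bound (X : finType) (P : X -> nat -> Prop) :
  (forall x k l, (k <= l)%N -> P x k -> P x l) -> (forall x, exists k, P x k) ->
  exists k, forall x, P x k.
Proof.
move=> mono /choice[k kP]; exists (\max_x k x) => x.
exact: mono (leq_bigmax x) (kP x).
Qed.

(** * Gluing subbundles given by generators on a cover *)

Section Glue.
Variables (A : comNzRingType) (k m p : nat) (J : finType) (s : J -> A).
Variable N : J -> 'M[A]_(p, m).
Hypothesis cover : forall (B : comNzRingType) (f : {rmorphism A -> B}),
  local_ring B -> exists j, invertible (f (s j)).
Hypothesis compat : forall (B : comNzRingType) (f : {rmorphism A -> B}),
  local_ring B -> forall j l, invertible (f (s j)) -> invertible (f (s l)) ->
  forall v, row_span (map_mx f (N j)) v -> row_span (map_mx f (N l)) v.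
Hypothesis subb : forall (B : comNzRingType) (f : {rmorphism A -> B}),
  local_ring B -> forall j, invertible (f (s j)) ->
  is_subbundle k (row_span (map_mx f (N j))).

(** [local_solve] turns membership over the local rings where [s j * s l] is invertible into an
    identity over [A], up to a power; there are finitely many indices, so one exponent serves
    all. *)
Lemma glue_generators : exists e, forall j l i, exists c : 'rV[A]_p,
  (s j * s l) ^+ e *: row i (N j) = c *m N l.
Proof.
pose P (x : J * J * 'I_p) e := exists c : 'rV[A]_p,
  (s x.1.1 * s x.1.2) ^+ e *: row x.2 (N x.1.1) = c *m N x.1.2.
have [||e eP] := @uniform_bound _ P; last first.
- by exists e => j l i; apply: (eP (j, l, i)).
- move=> [[j l] i]; rewrite /P /=.
  have [|e [c Ec]] := @local_solve A 'I_p 'I_m (fun i q => N l i q)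
      (fun q => N j i q) (s j * s l).
    move=> B f locB; rewrite rmorphM => /invertibleM[uj ul].
    have [c Ec] := compat locB uj ul (row_span_row (map_mx f (N j)) i).
    exists (fun i' => c 0 i') => q; move/rowP/(_ q): Ec; rewrite !mxE => ->.
    by apply: eq_bigr => i' _; rewrite !mxE.
  exists e, (\row_i' c i'); apply/rowP => q; rewrite !mxE Ec.
  by apply: eq_bigr => i' _; rewrite mxE.
move=> x a b ab [c Ec]; exists ((s x.1.1 * s x.1.2) ^+ (b - a) *: c).
by rewrite -scalemxAl -Ec scalerA -exprD subnK.
Qed.

(* A power of s j moves the rows of N j into the span of N l wherever s l is
   invertible, so the rescaled rows g of all the N j together have the right span
   over every local ring.  A projector onto it is obtained from a solution h of
   the linear system g h g = g. *)
Lemma glue : exists L : subbundle k m A,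
  forall (B : comNzRingType) (f : {rmorphism A -> B}), local_ring B ->
  forall j, invertible (f (s j)) ->
  forall v, extend f L v <-> row_span (map_mx f (N j)) v.
Proof.
have [e eP] := glue_generators.
pose g (x : J * 'I_p) := s x.1 ^+ e *: row x.2 (N x.1).
have g_span (B : comNzRingType) (f : {rmorphism A -> B}) (locB : local_ring B) l
    (ul : invertible (f (s l))) x : row_span (map_mx f (N l)) (map_mx f (g x)).
  have [c Ec] := eP x.1 l x.2; case: ul => u ul.
  exists (u ^+ e *: map_mx f c); rewrite -scalemxAl -map_mxM -Ec /g.
  rewrite !map_mxZ scalerA; congr (_ *: _).
  by rewrite !rmorphXn rmorphM exprMn mulrCA -exprMn [u * _]mulrC ul expr1n mulr1.
have span_g (B : comNzRingType) (f : {rmorphism A -> B}) l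
    (ul : invertible (f (s l))) v : row_span (map_mx f (N l)) v ->
    exists c : J * 'I_p -> B, v = \sum_x c x *: map_mx f (g x).
  move=> [c ->]; case: ul => u ul.
  exists (fun x => if x.1 == l then u ^+ e * c 0 x.2 else 0).
  rewrite mulmx_sum_row; symmetry.
  transitivity (\sum_j \sum_i (if j == l then u ^+ e * c 0 i else 0)
      *: map_mx f (g (j, i))).
    rewrite pair_bigA /=; apply: eq_bigr => -[j i] _ //=.
  rewrite (bigD1 l) //= [X in _ + X]big1 ?addr0; last first.
    by move=> j /negPf jl; rewrite big1 // => i _; rewrite jl scale0r.
  apply: eq_bigr => i _; rewrite eqxx /g map_mxZ map_row scalerA.
  by rewrite rmorphXn mulrAC -exprMn [u * _]mulrC ul expr1n mul1r.
clearbody g.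
have [|e' [h hP]] := @local_solve A ((J * 'I_p) * 'I_m)%type
   ((J * 'I_p) * 'I_m)%type
   (fun ya xq => g xq.1 0 ya.2 * g ya.1 0 xq.2) (fun xq => g xq.1 0 xq.2) 1.
  move=> B f locB _; have [l ul] := cover f locB.
  have [P [PP LP _]] := subb locB ul.
  (* Over a local ring, the rows of the projector written in the generators [g] solve the system. *)
  have /choice[c cP] a : exists c : J * 'I_p -> B,
      row a P = \sum_x c x *: map_mx f (g x).
    by apply: span_g ul _ _; apply/LP; rewrite -row_mul PP.
  exists (fun ya => c ya.2 ya.1) => -[x q] /=.
  have /LP /rowP /(_ q) := g_span B f locB l ul x.
  rewrite !mxE => <-.
  rewrite -(pair_bigA _ (fun y a => c a y * f (g x 0 a * g y 0 q))).
  rewrite exchange_big; apply: eq_bigr => a _ /=.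
  have /rowP/(_ q) := cP a; rewrite !mxE summxE => ->.
  by rewrite mulr_sumr; apply: eq_bigr => y _; rewrite !mxE rmorphM mulrCA.
pose P := \matrix_(a, q) \sum_y h (y, a) * g y 0 q.
have gP x : g x *m P = g x.
  apply/rowP => q; have := hP (x, q); rewrite expr1n mul1r /= => ->.
  transitivity (\sum_y \sum_a h (y, a) * (g x 0 a * g y 0 q)); last first.
    by rewrite pair_bigA /=; apply: eq_bigr => -[y a] _.
  rewrite exchange_big mxE; apply: eq_bigr => a _; rewrite mxE mulr_sumr.
  by apply: eq_bigr => y _; rewrite mulrCA.
have rowP a : row a P = \sum_y h (y, a) *: g y.
  by apply/rowP => q; rewrite !mxE summxE; apply: eq_bigr => y _; rewrite mxE.
have PP : P *m P = P.
  apply/row_matrixP => a; rewrite row_mul rowP mulmx_suml.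
  by apply: eq_bigr => y _; rewrite -scalemxAl gP.
have loc (B : comNzRingType) (f : {rmorphism A -> B}) (locB : local_ring B) l
    (ul : invertible (f (s l))) v :
    v *m map_mx f P = v <-> row_span (map_mx f (N l)) v.
  split=> [<-|/(span_g B f l ul)[c ->]].
    have [|D ->] := (row_spanP (map_mx f P) (map_mx f (N l))).1.
      move=> a; have /choice[c cP] := g_span B f locB l ul.
      exists (\sum_y f (h (y, a)) *: c y); rewrite -map_row rowP raddf_sum /=.
      by rewrite mulmx_suml; apply: eq_bigr => y _; rewrite map_mxZ cP -scalemxAl.
    by exists (v *m D); rewrite mulmxA.
  rewrite mulmx_suml; apply: eq_bigr => x _.
  by rewrite -scalemxAl -map_mxM gP.
have Lsub : is_subbundle k (fun v => v *m P = v).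
  (* A field is itself local, so [P] and the projector of some [N l] have the same row space
     there. *)
  exists P; split=> // F f; have locF := @field_local F.
  have [l ul] := cover f locF; have [P' [PP' LP' rk]] := subb locF ul.
  rewrite -(rk F idfun) map_mx_id //.
  apply: eqmx_rank; apply/andP; split; apply/submxP.
    exists (map_mx f P); apply/esym/row_matrixP => a; rewrite row_mul.
    by apply/LP'/(loc F f locF l ul); rewrite -row_mul -map_mxM PP.
  exists P'; apply/esym/row_matrixP => a; rewrite row_mul.
  by apply/(loc F f locF l ul)/LP'; rewrite -row_mul PP'.
exists (Subbundle Lsub) => B f locB l ul v.
by rewrite (extend_projector f PP) // (loc B f locB l ul).
Qed.

End Glue.

(** * Charts of the zero locus *)

(* The rows of fE, fF and fe are the vectors e_k, f_k and e; flam is the row of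
   the lam_k, and fbeta k j stands for lam_k / (lam_k + lam_j). *)
Record frame_data (A : Type) (n m : nat) := FrameData {
  fE : 'M[A]_(n, m); fF : 'M[A]_(n, m); fe : 'rV[A]_m;
  flam : 'rV[A]_n; fbeta : 'M[A]_n }.

Definition map_frame (A B : Type) (f : A -> B) n m (D : frame_data A n m) :=
  FrameData (map_mx f (fE D)) (map_mx f (fF D)) (map_mx f (fe D))
    (map_mx f (flam D)) (map_mx f (fbeta D)).

(** Everything is an equation or the existence of an inverse, hence stable under ring morphisms. In
    particular [frame_full] expresses that the vectors form a basis as a resolution of the identity,
    and [fbeta] is pinned down without division. *)
Record is_frame (A : comNzRingType) n m (Q w : 'M[A]_m) (D : frame_data A n m) :
    Prop := IsFrame {
  frame_sym : Q^T = Q;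
  frame_skew : w^T = - w;
  frame_EE : fE D *m Q *m (fE D)^T = 0;
  frame_FF : fF D *m Q *m (fF D)^T = 0;
  frame_EF : fE D *m Q *m (fF D)^T = 1%:M;
  frame_ee : fe D *m Q *m (fe D)^T = 1%:M;
  frame_Ee : fE D *m Q *m (fe D)^T = 0;
  frame_Fe : fF D *m Q *m (fe D)^T = 0;
  frame_full : Q *m (fF D)^T *m fE D + Q *m (fE D)^T *m fF D
    + Q *m (fe D)^T *m fe D = 1%:M;
  frame_wEE : fE D *m w *m (fE D)^T = 0;
  frame_wFF : fF D *m w *m (fF D)^T = 0;
  frame_wEF : fE D *m w *m (fF D)^T = diag_mx (flam D);
  frame_wEe : fE D *m w *m (fe D)^T = 0;
  frame_wFe : fF D *m w *m (fe D)^T = 0;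
  frame_wee : fe D *m w *m (fe D)^T = 0;
  frame_lam : forall i j, invertible (flam D 0 i + flam D 0 j);
  frame_beta : forall i j,
    fbeta D i j * (flam D 0 i + flam D 0 j) = flam D 0 i }.

Lemma frame_map (A B : comNzRingType) (f : {rmorphism A -> B}) n m
    (Q w : 'M[A]_m) (D : frame_data A n m) :
  is_frame Q w D -> is_frame (map_mx f Q) (map_mx f w) (map_frame f D).
Proof.
case: D => E F e lam beta.
case=> /= [sQ sw] EE FF EF ee Ee Fe full wEE wFF wEF wEe wFe wee li lb.
split=> /=; rewrite ?map_trmx -?map_mxM ?(EE, FF, EF, ee, Ee, Fe) ?map_mx0
  ?map_mx1 ?(wEE, wFF, wEF, wEe, wFe, wee, map_mx0) //.
- by rewrite sQ.
- by rewrite sw map_mxN.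
- by rewrite -!map_mxD full map_mx1.
- by rewrite map_diag_mx.
- by move=> i j; rewrite !mxE -rmorphD; apply: invertible_morph.
- by move=> i j; rewrite !mxE -rmorphD -rmorphM lb.
Qed.

(* The unique solution M of M + M^T + a a^T = 0 and diag(lam) M^T = M diag(lam),
   the equations expressing that the row span of E + a e + M F is isotropic for Q
   and for w. *)
Definition chart_coef (A : comNzRingType) n (beta : 'M[A]_n) (a : 'cV[A]_n) :=
  \matrix_(k, j) - (beta k j * (a k 0 * a j 0)).

Definition chart (A : comNzRingType) n m (D : frame_data A n m) (a : 'cV[A]_n) :
  'M[A]_(n, m) := fE D + a *m fe D + chart_coef (fbeta D) a *m fF D.

Lemma mulmx_tr_row (A : comNzRingType) p q m (M : 'M[A]_(p, m))
    (N : 'M[A]_(q, m)) k l : (M *m N^T) k l = (M *m (row l N)^T) k 0.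
Proof. by rewrite !mxE; apply: eq_bigr => ? _; rewrite !mxE. Qed.

Section Frame.
Variables (A : comNzRingType) (n m : nat) (Q w : 'M[A]_m).

Section One.
Variable (D : frame_data A n m).
Hypothesis frD : is_frame Q w D.
Local Notation E := (fE D).
Local Notation F := (fF D).
Local Notation e := (fe D).

Let sQ (p q : nat) (M : 'M[A]_(p, m)) (N : 'M[A]_(q, m)) :
  M *m Q *m N^T = (N *m Q *m M^T)^T.
Proof. by rewrite !trmx_mul trmxK (frame_sym frD) mulmxA. Qed.
Let sw (p q : nat) (M : 'M[A]_(p, m)) (N : 'M[A]_(q, m)) :
  M *m w *m N^T = - (N *m w *m M^T)^T.
Proof.
by rewrite !trmx_mul trmxK (frame_skew frD) mulNmx mulmxN opprK mulmxA.
Qed.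

Let gram := (frame_EE frD, frame_FF frD, frame_EF frD, frame_ee frD,
  frame_Ee frD, frame_Fe frD, frame_wEE frD, frame_wFF frD, frame_wEF frD,
  frame_wEe frD, frame_wFe frD, frame_wee frD).

Lemma frame_FE : F *m Q *m E^T = 1%:M.
Proof. by rewrite sQ gram trmx1. Qed.
Lemma frame_eE : e *m Q *m E^T = 0.
Proof. by rewrite sQ gram trmx0. Qed.
Lemma frame_eF : e *m Q *m F^T = 0.
Proof. by rewrite sQ gram trmx0. Qed.
Lemma frame_wFE : F *m w *m E^T = - diag_mx (flam D).
Proof. by rewrite sw gram tr_diag_mx. Qed.
Lemma frame_weE : e *m w *m E^T = 0.
Proof. by rewrite sw gram trmx0 oppr0. Qed.
Lemma frame_weF : e *m w *m F^T = 0.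
Proof. by rewrite sw gram trmx0 oppr0. Qed.

Let gram' := (gram, frame_FE, frame_eE, frame_eF, frame_wFE, frame_weE,
  frame_weF).

Lemma frame_expand p (Y : 'M[A]_(p, m)) : Y = Y *m Q *m F^T *m E
  + Y *m Q *m e^T *m e + Y *m Q *m E^T *m F.
Proof.
by rewrite -[LHS]mulmx1 -(frame_full frD) !mulmxDr !mulmxA addrAC.
Qed.

Lemma chartF (a : 'cV[A]_n) : chart D a *m Q *m F^T = 1%:M.
Proof.
by rewrite /chart !mulmxDl -!mulmxA !(mulmxA _ Q) !gram' !mulmx0 !addr0.
Qed.
Lemma charte (a : 'cV[A]_n) : chart D a *m Q *m e^T = a.
Proof.
by rewrite /chart !mulmxDl -!mulmxA !(mulmxA _ Q) !gram' !mulmx0 mulmx1 add0r addr0.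
Qed.
Lemma chartE (a : 'cV[A]_n) :
  chart D a *m Q *m E^T = chart_coef (fbeta D) a.
Proof.
by rewrite /chart !mulmxDl -!mulmxA !(mulmxA _ Q) !gram' !mulmx0 mulmx1 !add0r.
Qed.

Lemma gramQ p (Y : 'M[A]_(n, m)) (Z : 'M[A]_(p, m)) a M :
  Y = E + a *m e + M *m F ->
  Z *m Q *m Y^T = Z *m Q *m E^T + Z *m Q *m e^T *m a^T + Z *m Q *m F^T *m M^T.
Proof. by move=> ->; rewrite !linearD /= !trmx_mul !mulmxA. Qed.

Lemma gramw (Y : 'M[A]_(n, m)) a M :
  Y = E + a *m e + M *m F ->
  Y *m w *m Y^T = diag_mx (flam D) *m M^T - M *m diag_mx (flam D).
Proof.
move=> EY.
have YE : Y *m w *m E^T = - (M *m diag_mx (flam D)).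
  rewrite EY !mulmxDl -!mulmxA !(mulmxA _ w) !gram' !mulmx0 !add0r.
  by rewrite mulmxN.
have YF : Y *m w *m F^T = diag_mx (flam D).
  by rewrite EY !mulmxDl -!mulmxA !(mulmxA _ w) !gram' !mulmx0 !addr0.
have Ye : Y *m w *m e^T = 0.
  by rewrite EY !mulmxDl -!mulmxA !(mulmxA _ w) !gram' !mulmx0 !addr0.
rewrite {2}EY !linearD /= !trmx_mul !mulmxA YE YF Ye mul0mx addr0.
by rewrite addrC.
Qed.

Lemma lam_cancel i j x y :
  (flam D 0 i + flam D 0 j) * x = (flam D 0 i + flam D 0 j) * y -> x = y.
Proof.
have [u Eu] := frame_lam frD i j => /(congr1 (fun z => u * z)).
by rewrite !mulrA [u * _]mulrC Eu !mul1r.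
Qed.

Lemma betaD i j : fbeta D i j + fbeta D j i = 1.
Proof.
apply: (@lam_cancel i j).
transitivity (fbeta D i j * (flam D 0 i + flam D 0 j)
  + fbeta D j i * (flam D 0 j + flam D 0 i)); first by ring.
by rewrite !(frame_beta frD) mulr1.
Qed.

Lemma beta2 i : 2 * fbeta D i i = 1.
Proof. by rewrite mulr_natl mulr2n betaD. Qed.

(** Both sides are lam_i lam_j / (lam_i + lam_j). *)
Lemma beta_lam i j : flam D 0 i * fbeta D j i = flam D 0 j * fbeta D i j.
Proof.
apply: (@lam_cancel i j).
transitivity (flam D 0 i * (fbeta D j i * (flam D 0 j + flam D 0 i))).
  by ring.
rewrite (frame_beta frD).
transitivity (flam D 0 j * (fbeta D i j * (flam D 0 i + flam D 0 j))).
  by rewrite (frame_beta frD); ring.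
by ring.
Qed.

(** Isotropy for [Q] gives M_kj + M_jk = - a_k a_j, isotropy for [w] gives lam_k M_jk = lam_j M_kj;
    eliminating M_jk leaves (lam_k + lam_j) M_kj = - lam_k a_k a_j. *)
Lemma isotropic_chart (Y : 'M[A]_(n, m)) : Y *m Q *m F^T = 1%:M ->
  Y *m Q *m Y^T = 0 -> Y *m w *m Y^T = 0 -> Y = chart D (Y *m Q *m e^T).
Proof.
move=> YF QY wY; have EY := frame_expand Y.
rewrite YF mul1mx in EY; have := gramQ Y EY; have := gramw EY.
rewrite YF mul1mx QY wY [Y in Y = chart _ _]EY.
set a := Y *m Q *m e^T; set M := Y *m Q *m E^T => wM QM.
clearbody a M; rewrite /chart; congr (_ + _ *m _); apply/matrixP => k j.
move/matrixP/(_ k j): wM; rewrite mul_diag_mx mul_mx_diag !mxE => /esym wkj.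
move/matrixP/(_ k j): QM; rewrite !mxE big_ord1 mxE => Qkj.
apply: (@lam_cancel k j).
transitivity (flam D 0 k * (M k j + M j k) + (M k j * flam D 0 j
  - flam D 0 k * M j k)); first by ring.
have -> : M k j + M j k = - (a k 0 * a j 0).
  by apply/eqP; rewrite -subr_eq0 Qkj; apply/eqP; ring.
move/eqP: wkj; rewrite subr_eq0 => /eqP ->; rewrite subrr addr0.
by rewrite -[in LHS](frame_beta frD k j); ring.
Qed.

Lemma chart_isotropicQ a : chart D a *m Q *m (chart D a)^T = 0.
Proof.
rewrite (gramQ _ (erefl (chart D a))) chartE chartF charte mul1mx.
apply/matrixP => k j; rewrite !mxE big_ord1 !mxE.
transitivity (a k 0 * a j 0 * (1 - (fbeta D k j + fbeta D j k))); first by ring.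
by rewrite betaD subrr mulr0.
Qed.

Lemma chart_isotropicw a : chart D a *m w *m (chart D a)^T = 0.
Proof.
rewrite (gramw (erefl (chart D a))) mul_diag_mx mul_mx_diag.
apply/matrixP => k j; rewrite !mxE.
transitivity (a k 0 * a j 0 * (flam D 0 j * fbeta D k j - flam D 0 k * fbeta D j k)).
  by ring.
by rewrite beta_lam subrr mulr0.
Qed.

(** Both charts pair with [F] to the identity, which forces the transition matrix [C] to be the
    identity. *)
Lemma chart_inj a a' :
  (forall v, row_span (chart D a) v -> row_span (chart D a') v) -> a = a'.
Proof.
move=> sub; have [|C EC] := (row_spanP (chart D a) (chart D a')).1.
  by move=> i; apply/sub/row_span_row.
have C1 : C = 1%:M.
  by have := chartF a; rewrite EC -!mulmxA !(mulmxA _ Q) chartF mulmx1.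
by rewrite -(charte a) EC C1 mul1mx charte.
Qed.

End One.

(* The coordinates of the rows of chart D a with respect to fF D' form the
   identity matrix up to column i, whose inverse is T; the new parameters are
   then read off as the coordinates of T times the chart along e. *)
Lemma chart_flip (D D' : frame_data A n m) (i : 'I_n) (a : 'cV[A]_n) :
  is_frame Q w D -> is_frame Q w D' -> fe D' = fe D ->
  row i (fF D') = row i (fE D) ->
  (forall l, l != i -> row l (fF D') = row l (fF D)) ->
  invertible (a i 0) ->
  exists a' : 'cV[A]_n,
    [/\ forall v, row_span (chart D a) v <-> row_span (chart D' a') v,
        a' i 0 * a i 0 = - 2
      & forall k, k != i -> a' k 0 = a k 0 * (1 - 2 * fbeta D k i)].
Proof.
move=> frD frD' ee' Fi Fl [u au].
set X := chart D a; pose M := chart_coef (fbeta D) a.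
(* The inverse of M_ii = - a_i^2 / 2. *)
pose z := - (2 * (u * u)).
have Mi : z * M i i = 1.
  rewrite mxE /z; transitivity (2 * fbeta D i i * (a i 0 * u) * (a i 0 * u)).
    by ring.
  by rewrite au beta2 // !mulr1.
pose C := X *m Q *m (fF D')^T.
have Cl k l : l != i -> C k l = (k == l)%:R.
  move=> li; rewrite /C mulmx_tr_row Fl // -mulmx_tr_row chartF //.
  by rewrite mxE.
have Ci k : C k i = M k i.
  by rewrite /C mulmx_tr_row Fi -mulmx_tr_row chartE.
(* Adding [x k] times row [i] of [C] to row [k] clears column [i] down to the unit vector. *)
pose x : 'cV[A]_n := \col_k - (z * (M k i - (k == i)%:R)).
have xE k : x k 0 = - (z * (M k i - (k == i)%:R)) by rewrite mxE.
have ME k : M k i = - (fbeta D k i * (a k 0 * a i 0)) by rewrite mxE.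
pose T : 'M[A]_n := 1%:M + x *m delta_mx 0 i.
have TX p (Z : 'M[A]_(n, p)) k l : (T *m Z) k l = Z k l + x k 0 * Z i l.
  by rewrite mulmxDl mul1mx mxE -mulmxA -rowE mxE big_ord1 [row _ _ _ _]mxE.
have TC : T *m C = 1%:M.
  apply/matrixP => k l; rewrite TX [RHS]mxE.
  have [->|li] := eqVneq l i; last first.
    by rewrite !Cl // [i == l]eq_sym (negPf li) mulr0 addr0.
  rewrite !Ci xE.
  transitivity (M k i - z * M i i * (M k i - (k == i)%:R)); first by ring.
  by rewrite Mi; ring.
pose Y := T *m X.
have YF : Y *m Q *m (fF D')^T = 1%:M by rewrite -!mulmxA !(mulmxA X) TC.
have Yc : Y = chart D' (T *m a).
  rewrite {1}(isotropic_chart frD' YF); last 2 first.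
  - rewrite /Y trmx_mul -!mulmxA [X *m _]mulmxA [X *m Q *m _]mulmxA.
    by rewrite chart_isotropicQ // mul0mx mulmx0.
  - rewrite /Y trmx_mul -!mulmxA [X *m _]mulmxA [X *m w *m _]mulmxA.
    by rewrite chart_isotropicw // mul0mx mulmx0.
  by rewrite ee' /Y -!mulmxA (mulmxA X) charte.
exists (T *m a); split.
- move=> v; rewrite -Yc; split.
    apply: (@row_span_sub _ _ _ _ _ _ C).
    by rewrite /Y mulmxA (mulmx1C TC) mul1mx.
  exact: row_span_sub (erefl _).
- rewrite TX xE eqxx mulr1n.
  transitivity (a i 0 * a i 0 * z + a i 0 * a i 0 * (1 - z * M i i)).
    by ring.
  rewrite Mi /z; transitivity (- (2 * (a i 0 * u) * (a i 0 * u))); first by ring.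
  by rewrite au; ring.
move=> k /negPf ki; rewrite TX xE ME ki mulr0n.
transitivity (a k 0 * (1 - 2 * fbeta D k i * (a i 0 * u) * (a i 0 * u))).
  by rewrite /z; ring.
by rewrite au !mulr1.
Qed.
End Frame.

(** * Comparison with the product of projective lines *)

(* Homogeneous coordinates (s : x) for b = false, (x : s) for b = true. *)
Definition line (A : comNzRingType) (b : bool) (s x : A) : 'rV[A]_2 :=
  \row_j (if (j == ord0) == b then x else s).

Lemma map_line (A B : comNzRingType) (f : {rmorphism A -> B}) b s x :
  map_mx f (line b s x) = line b (f s) (f x).
Proof. by apply/rowP => j; rewrite !mxE; case: ifP. Qed.

(** Names the places of the two coordinates once, so that the arguments using it need no case
    distinction on [b]. *)
Lemma line_pos (A : comNzRingType) b (s x : A) :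
  exists j j', forall s' x' : A, line b s' x' 0 j = x' /\ line b s' x' 0 j' = s'
    /\ line (~~ b) s' x' 0 j = s' /\ line (~~ b) s' x' 0 j' = x'.
Proof.
exists (if b then ord0 else 1), (if b then 1 else ord0) => s' x'.
by case: b; rewrite !mxE.
Qed.

Lemma row_spanP1 (A : comNzRingType) m (u v : 'rV[A]_m) :
  row_span u v <-> exists c, v = c *: u.
Proof.
split=> [[c ->]|[c ->]]; last by exists c%:M; rewrite mul_scalar_mx.
by exists (c 0 0); rewrite [c]mx11_scalar mul_scalar_mx mxE eqxx.
Qed.

Lemma line_inj (A : comNzRingType) b (x x' : A) :
  row_span (line b 1 x) (line b 1 x') -> x = x'.
Proof.
move=> /row_spanP1[c Ec]; have [j [j' P]] := line_pos b 1 x.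
have E q : line b 1 x' 0 q = c * line b 1 x 0 q by rewrite Ec mxE.
move: (E j) (E j').
have [-> [-> _]] := P 1 x; have [-> [-> _]] := P 1 x'.
by rewrite mulr1 => -> <-; rewrite mul1r.
Qed.

Lemma line_inv (A : comNzRingType) b (x x' : A) :
  row_span (line b 1 x) (line (~~ b) 1 x') -> x * x' = 1.
Proof.
move=> /row_spanP1[c Ec]; have [j [j' P]] := line_pos b 1 x.
have E q : line (~~ b) 1 x' 0 q = c * line b 1 x 0 q by rewrite Ec mxE.
move: (E j) (E j').
have [-> [-> _]] := P 1 x; have [_ [_ [-> ->]]] := P 1 x'.
by rewrite mulr1 => -> ->; rewrite mulrC.
Qed.

Lemma line_flip (A : comNzRingType) b (x x' : A) v :
  x * x' = 1 -> row_span (line b 1 x) v -> row_span (line (~~ b) 1 x') v.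
Proof.
move=> xx'; apply: (@row_span_sub _ _ _ _ _ _ x%:M).
rewrite mul_scalar_mx; apply/rowP => j; rewrite !mxE.
by case: b; case: (j == ord0); rewrite /= ?mulr1 ?xx'.
Qed.

Lemma line_scale (A : comNzRingType) b (s x u : A) v : s * u = 1 ->
  row_span (line b s x) v <-> row_span (line b 1 (u * x)) v.
Proof.
move=> su; split.
  apply: (@row_span_sub _ _ _ _ _ _ s%:M); rewrite mul_scalar_mx.
  by apply/rowP => j; rewrite !mxE; case: ifP; rewrite ?mulr1 // mulrA su mul1r.
apply: (@row_span_sub _ _ _ _ _ _ u%:M); rewrite mul_scalar_mx.
by apply/rowP => j; rewrite !mxE; case: ifP => //; rewrite mulrC su.
Qed.

(** * The charts indexed by subsets J and their transition maps *)

Definition toggle n (J : {set 'I_n}) i := [set k | (k == i) (+) (k \in J)].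

Section Flip.
Variables (K : fieldType) (n m : nat) (D : frame_data K n m).
Implicit Types (J : {set 'I_n}) (i j k : 'I_n).

(* The sign changes w(e_k, f_k) for the k in J, where e_k and f_k are
   exchanged. *)
Definition slam J k := if k \in J then - flam D 0 k else flam D 0 k.

Definition flip J := FrameData
  (\matrix_k (if k \in J then row k (fF D) else row k (fE D)))
  (\matrix_k (if k \in J then row k (fE D) else row k (fF D)))
  (fe D) (\row_k slam J k)
  (\matrix_(k, j) (slam J k / (slam J k + slam J j))).

(* Rescaling a_k by twist J k absorbs the factors 1 - 2 beta k i produced by the
   flips, so that the coordinate of the k-th line depends on the chart only
   through the inversion. *)
Definition twist J k : K := (if k \in J then - 2^-1 else 1) *
  \prod_(j | j != k)
    (if j \in J then (flam D 0 j + slam J k) / (flam D 0 j - slam J k) else 1).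

Hypothesis lamD : forall i j, flam D 0 i + flam D 0 j != 0.
Hypothesis lamB : forall i j, i != j -> flam D 0 i - flam D 0 j != 0.

Lemma slamD J i j : slam J i + slam J j != 0.
Proof.
have Np (x : K) : - x != 0 = (x != 0) by rewrite oppr_eq0.
rewrite /slam; case: ifP => iJ; case: ifP => jJ; rewrite ?lamD //.
- by rewrite -opprD Np.
- by rewrite addrC lamB //; apply: contraFN jJ => /eqP ->.
- by rewrite lamB //; apply: contraFN iJ => /eqP ->.
Qed.

Lemma lam_slamD J i j : i != j ->
  flam D 0 i + slam J j != 0 /\ flam D 0 i - slam J j != 0.
Proof. by move=> ij; rewrite /slam; case: ifP; rewrite ?opprK lamD lamB. Qed.

Lemma toggleE J i k : (k \in toggle J i) = (k == i) (+) (k \in J).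
Proof. by rewrite inE. Qed.

Lemma slam_toggle J i k :
  slam (toggle J i) k = if k == i then - slam J k else slam J k.
Proof.
rewrite /slam toggleE; case: eqP => //= _; case: (k \in J) => //=.
by rewrite opprK.
Qed.

Hypothesis two0 : (2 : K) != 0.

Lemma twist_neq0 J k : twist J k != 0.
Proof.
rewrite mulf_neq0 //.
  by case: ifP; rewrite ?oner_neq0 // oppr_eq0 invr_eq0.
apply/prodf_neq0 => j jk; case: ifP => _; rewrite ?oner_neq0 //.
by have [? ?] := lam_slamD J jk; rewrite mulf_neq0 ?invr_eq0.
Qed.

(** Only the factor at [j = i] differs between the two twists, and 1 - 2 beta_ki equals (s_i - s_k)
    / (s_i + s_k) for the signed eigenvalues s = [slam J]. *)
Lemma twist_toggle_neq J i k : k != i ->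
  twist (toggle J i) k * (1 - 2 * fbeta (flip J) k i) = twist J k.
Proof.
move=> ki; have ik : i != k by rewrite eq_sym.
rewrite /twist toggleE slam_toggle (negPf ki) /= -mulrA; congr (_ * _).
rewrite (bigD1 i) // [RHS](bigD1 i) //= mulrAC; congr (_ * _); last first.
  by apply: eq_bigr => j /andP[_ /negPf ji]; rewrite toggleE ji.
rewrite toggleE eqxx /= mxE.
have := slamD J k i; have [] := lam_slamD J ik; move: (slam J k) => s.
rewrite /slam; case: (i \in J) => /= p q r; field; rewrite ?p ?q ?r //.
Qed.

(** Negating s_i inverts each factor with [j != i], so only the leading constants remain. The value
    is the inverse of a_i a'_i = - 2, which makes the rescaled i-th coordinates inverse to each
    other. *)
Lemma twist_toggle_eq J i : twist J i * twist (toggle J i) i = - 2^-1.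
Proof.
rewrite /twist toggleE slam_toggle eqxx mulrACA -big_split big1 /=.
  by case: (i \in J); rewrite /= ?mulr1 ?mul1r.
move=> j ji; rewrite toggleE (negPf ji) /=; case: ifP => _; rewrite ?mulr1 //.
have [p q] := lam_slamD J ji.
by rewrite opprK mulrA -[_ / _ * _]mulrA; field; rewrite p q.
Qed.

Lemma bil_entry (A : comNzRingType) p q (M : 'M[A]_(p, m)) G
    (N : 'M[A]_(q, m)) (k : 'I_p) (j : 'I_q) :
  (M *m G *m N^T) k j = (row k M *m G *m (row j N)^T) 0 0.
Proof. by rewrite mulmx_tr_row -!row_mul [RHS]mxE. Qed.

(** Exchanging e_k and f_k preserves the [Q]-products by symmetry and negates w(e_k, f_k) by
    skewness. *)
Lemma flip_frame (Q w : 'M[K]_m) J :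
  is_frame Q w D -> is_frame Q w (flip J).
Proof.
move=> fr; pose gram := (frame_EE fr, frame_FF fr, frame_EF fr, frame_ee fr,
  frame_Ee fr, frame_Fe fr, frame_wEE fr, frame_wFF fr, frame_wEF fr,
  frame_wEe fr, frame_wFe fr, frame_wee fr, frame_FE fr, frame_eE fr,
  frame_eF fr, frame_wFE fr, frame_weE fr, frame_weF fr).
have neq k j : k \in J -> j \in J = false -> k == j = false.
  by move=> kJ jJ; apply: contraFF jJ => /eqP <-.
have neq' k j : k \in J = false -> j \in J -> k == j = false.
  by move=> kJ jJ; rewrite eq_sym neq.
have rowe : fe D = row 0 (fe D) by rewrite row_id.
split=> /=; rewrite ?(frame_sym fr, frame_skew fr, frame_ee fr, frame_wee fr) //.
- apply/matrixP => k j; rewrite bil_entry !rowK; case: ifP => kJ;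
    case: ifP => jJ; rewrite -bil_entry gram !mxE ?(neq _ _ kJ jJ)
    ?(neq' _ _ kJ jJ) /slam ?kJ ?mulr0n ?mulNrn ?oppr0 //.
- apply/matrixP => k j; rewrite bil_entry !rowK; case: ifP => kJ;
    case: ifP => jJ; rewrite -bil_entry gram !mxE ?(neq _ _ kJ jJ)
    ?(neq' _ _ kJ jJ) /slam ?kJ ?mulr0n ?mulNrn ?oppr0 //.
- apply/matrixP => k j; rewrite bil_entry !rowK; case: ifP => kJ;
    case: ifP => jJ; rewrite -bil_entry gram !mxE ?(neq _ _ kJ jJ)
    ?(neq' _ _ kJ jJ) /slam ?kJ ?mulr0n ?mulNrn ?oppr0 //.
- apply/matrixP => k j; rewrite bil_entry rowK [row j _]row_id.
  by case: ifP => kJ; rewrite -[fe D](row_id 0) -bil_entry ord1 gram !mxE.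
- apply/matrixP => k j; rewrite bil_entry rowK [row j _]row_id.
  by case: ifP => kJ; rewrite -[fe D](row_id 0) -bil_entry ord1 gram !mxE.
- rewrite -(frame_full fr) -!mulmxA -!mulmxDr; congr (Q *m (_ + _)).
  apply/matrixP => p q; rewrite !mxE -!big_split /=; apply: eq_bigr => k _.
  by rewrite !mxE; case: ifP; rewrite !mxE // addrC.
- apply/matrixP => k j; rewrite bil_entry !rowK; case: ifP => kJ;
    case: ifP => jJ; rewrite -bil_entry gram !mxE ?(neq _ _ kJ jJ)
    ?(neq' _ _ kJ jJ) /slam ?kJ ?mulr0n ?mulNrn ?oppr0 //.
- apply/matrixP => k j; rewrite bil_entry !rowK; case: ifP => kJ;
    case: ifP => jJ; rewrite -bil_entry gram !mxE ?(neq _ _ kJ jJ)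
    ?(neq' _ _ kJ jJ) /slam ?kJ ?mulr0n ?mulNrn ?oppr0 //.
- apply/matrixP => k j; rewrite bil_entry !rowK; case: ifP => kJ;
    case: ifP => jJ; rewrite -bil_entry gram !mxE ?(neq _ _ kJ jJ)
    ?(neq' _ _ kJ jJ) /slam ?kJ ?mulr0n ?mulNrn ?oppr0 //.
- apply/matrixP => k j; rewrite bil_entry rowK [row j _]row_id.
  by case: ifP => kJ; rewrite -[fe D](row_id 0) -bil_entry ord1 gram !mxE.
- apply/matrixP => k j; rewrite bil_entry rowK [row j _]row_id.
  by case: ifP => kJ; rewrite -[fe D](row_id 0) -bil_entry ord1 gram !mxE.
- by move=> i j; rewrite !mxE; apply/invertible_field/slamD.
- by move=> i j; rewrite !mxE mulfVK // slamD.
Qed.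

Variables (Q w : 'M[K]_m).
Hypothesis frD : is_frame Q w D.

Section Over.
Variables (B : comNzRingType) (iota : {rmorphism K -> B}).
Implicit Type a : 'cV[B]_n.

Definition fchart J a := chart (map_frame iota (flip J)) a.
Definition fline J a i := line (i \in J) 1 (iota (twist J i) * a i 0).

Let frJ J := frame_map iota (flip_frame J frD).

Lemma invertible_iota (x : K) : x != 0 -> invertible (iota x).
Proof. by move=> x0; apply/invertible_morph/invertible_field. Qed.

(** The last clause allows flips to be iterated: a parameter that is a unit before the flip is still
    one after it. *)
Lemma fchart_toggle J i a : invertible (a i 0) -> exists a',
  [/\ forall v, row_span (fchart J a) v <-> row_span (fchart (toggle J i) a') v,
      forall k v, row_span (fline J a k) v <-> row_span (fline (toggle J i) a' k) v
    & forall k, invertible (a k 0) -> invertible (a' k 0)].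
Proof.
move=> ui.
have [|||a' [Xa' a'i a'k]] := chart_flip (frJ J) (frJ (toggle J i)) _ _ _ ui.
- by [].
- by rewrite /= -!map_row !rowK toggleE eqxx; case: (i \in J).
- by move=> l /negPf li; rewrite /= -!map_row !rowK toggleE li.
have i2 : iota (- 2) * - iota 2^-1 = 1.
  by rewrite -rmorphN -rmorphM mulrNN mulfV ?rmorph1.
have tw := twist_toggle_eq J i.
have pos : iota (twist J i) * a i 0 * (iota (twist (toggle J i) i) * a' i 0) = 1.
  rewrite mulrACA -rmorphM tw [a i 0 * _]mulrC a'i rmorphN mulNr mulrN opprK.
  by rewrite -(rmorph_nat iota 2) -rmorphM mulVf ?rmorph1.
have bE k : 1 - 2 * fbeta (map_frame iota (flip J)) k i
    = iota (1 - 2 * fbeta (flip J) k i).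
  by rewrite rmorphB rmorph1 rmorphM rmorph_nat [in LHS]mxE.
have flE k : k != i -> fline (toggle J i) a' k = fline J a k.
  move=> ki; rewrite /fline toggleE (negPf ki) a'k // -(twist_toggle_neq J ki).
  by congr line; rewrite bE [iota (_ * _)]rmorphM mulrCA mulrC.
exists a'; split=> //.
  move=> k v; have [->|ki] := eqVneq k i; last by rewrite flE.
  have tog : (i \in toggle J i) = ~~ (i \in J) by rewrite toggleE eqxx.
  rewrite /fline tog; split; first exact: line_flip.
  rewrite -{2}[i \in J]negbK; apply: line_flip.
  by rewrite mulrC.
move=> k uk; have [->|ki] := eqVneq k i.
  have /invertibleM[] // : invertible (iota (twist (toggle J i) i) * a' i 0).
  by exists (iota (twist J i) * a i 0); rewrite mulrC.
rewrite a'k //; apply/invertibleM; split=> //.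
rewrite bE; apply: invertible_iota; apply/eqP => E.
by have := twist_neq0 J k; rewrite -(twist_toggle_neq J ki) E mulr0 eqxx.
Qed.

(** Induction on the number of indices at which the two subsets differ, flipping one at a time. *)
Lemma fchart_change J J' a :
  (forall i, (i \in J) != (i \in J') -> invertible (a i 0)) -> exists a',
  (forall v, row_span (fchart J a) v <-> row_span (fchart J' a') v) /\
  (forall k v, row_span (fline J a k) v <-> row_span (fline J' a' k) v).
Proof.
have [N] := ubnP #|[set i | (i \in J) != (i \in J')]|.
elim: N => // N IH in J a *; rewrite ltnS => leN ua.
have [/setP eJ|[i iJJ']] := set_0Vmem [set i | (i \in J) != (i \in J')].
  have -> : J' = J.
    by apply/setP => i; have := eJ i; rewrite !inE => /negbFE/eqP.
  by exists a.
have ui : invertible (a i 0) by apply: ua; rewrite inE in iJJ'.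
have [a1 [Xa1 La1 ua1]] := fchart_toggle J ui.
have togD k : ((k \in toggle J i) != (k \in J')) =
    (k != i) && ((k \in J) != (k \in J')).
  rewrite toggleE; have [->|//] := eqVneq k i.
  by rewrite inE in iJJ'; move: iJJ'; case: (i \in J); case: (i \in J').
have [||a' [Xa' La']] := IH (toggle J i) a1.
- apply: leq_trans _ leN; apply: proper_card; apply/properP; split.
    by apply/subsetP => k; rewrite !inE -toggleE togD => /andP[].
  by exists i => //; rewrite inE togD eqxx.
- by move=> k; rewrite togD => /andP[_ /ua]; apply: ua1.
exists a'; split=> [v|k v]; first by rewrite Xa1.
by rewrite La1.
Qed.

(* A row i with i in exactly one of J, J' has only multiples of a_i as
   coordinates in the second chart, where the coordinate matrix is invertible. *)
Lemma fchart_units J J' a a' :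
  (forall v, row_span (fchart J a) v <-> row_span (fchart J' a') v) ->
  forall i, (i \in J) != (i \in J') -> invertible (a i 0).
Proof.
move=> eqX i iJ.
have [|G EG] := (row_spanP (fchart J a) (fchart J' a')).1.
  by move=> k; apply/eqX/row_span_row.
have [|T ET] := (row_spanP (fchart J' a') (fchart J a)).1.
  by move=> k; apply/eqX/row_span_row.
have GT : G *m T = 1%:M.
  have := chartF (frJ J) a; rewrite -/(fchart J a) {1}EG {1}ET => <-.
  by rewrite -[LHS]mulmx1 -(chartF (frJ J) a) !mulmxA.
have Gi l : exists r, G i l = a i 0 * r.
  have -> : G = fchart J a *m map_mx iota Q *m (map_mx iota (fF (flip J')))^T.
    rewrite EG -!mulmxA [_ *m (map_mx iota Q *m _)]mulmxA.
    by rewrite (chartF (frJ J') a') mulmx1.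
  rewrite mulmx_tr_row; have [lJ|lJ] := eqVneq (l \in J) (l \in J').
    exists 0; rewrite mulr0.
    have -> : row l (map_mx iota (fF (flip J'))) = row l (map_mx iota (fF (flip J))).
      by rewrite /= -!map_row !rowK lJ.
    rewrite -mulmx_tr_row (chartF (frJ J) a) mxE.
    by case: eqP => // il; rewrite il lJ eqxx in iJ.
  have -> : row l (map_mx iota (fF (flip J'))) = row l (map_mx iota (fE (flip J))).
    rewrite /= -!map_row !rowK.
    by case: (l \in J) lJ; case: (l \in J').
  rewrite -mulmx_tr_row (chartE (frJ J) a) mxE.
  exists (- (fbeta (map_frame iota (flip J)) i l * a l 0)); ring.
have /choice[r Er] := Gi.
have /matrixP/(_ i i) := GT; rewrite !mxE eqxx => Ei.
exists (\sum_l r l * T l i); rewrite mulr_sumr -[RHS]Ei.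
by apply: eq_bigr => l _; rewrite Er mulrA.
Qed.

Definition related (L : 'rV[B]_m -> Prop) (y : 'I_n -> 'rV[B]_2 -> Prop) : Prop :=
  exists J a, (forall v, L v <-> row_span (fchart J a) v) /\
    (forall i v, y i v <-> row_span (fline J a i) v).

(** By [fchart_units] the first chart can be rewritten over J', where the plane determines the
    parameters by [chart_inj]. *)
Lemma related_fun L L' y y' : related L y -> related L' y' ->
  (forall v, L v <-> L' v) -> forall i v, y i v <-> y' i v.
Proof.
move=> [J [a [La ya]]] [J' [a' [La' ya']]] LL' i v; rewrite ya ya'.
have aa' u : row_span (fchart J a) u <-> row_span (fchart J' a') u.
  by rewrite -La -La'.
have [a1 [Xa1 La1]] := fchart_change (fchart_units aa').
suff <- : a1 = a' by apply: La1.
by apply: (chart_inj (frJ J')) => u /Xa1/aa'.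
Qed.

(** Here the units come from the lines: at an index where J and J' differ, the two affine
    coordinates are inverse to each other. *)
Lemma related_inj L L' y y' : related L y -> related L' y' ->
  (forall i v, y i v <-> y' i v) -> forall v, L v <-> L' v.
Proof.
move=> [J [a [La ya]]] [J' [a' [La' ya']]] yy' v; rewrite La La'.
have aa' i u : row_span (fline J a i) u <-> row_span (fline J' a' i) u.
  by rewrite -ya -ya'.
have [|a1 [Xa1 La1]] := @fchart_change J J' a.
  move=> i iJ.
  have NJ : (i \in J') = ~~ (i \in J) by case: (i \in J) iJ; case: (i \in J').
  have : row_span (fline J a i) (fline J' a' i)
    by apply/aa'; rewrite -[X in row_span _ X](row_id 0); apply: row_span_row.
  rewrite /fline NJ => /line_inv; rewrite -mulrA mulrCA => ai.
  have /invertibleM[] // : invertible (a i 0 * (iota (twist J i)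
     * (iota (twist J' i) * a' i 0))) by exists 1; rewrite mulr1.
suff <- : a1 = a' by apply: Xa1.
apply/colP => i.
have [u] := invertible_iota (twist_neq0 J' i).
have : iota (twist J' i) * a1 i 0 = iota (twist J' i) * a' i 0.
  apply: line_inj; apply/La1/aa'.
  by rewrite -[X in row_span _ X](row_id 0); apply: row_span_row.
move=> /(congr1 (fun z => u * z)) /=; rewrite !mulrA [u * _]mulrC => + E.
by rewrite E !mul1r.
Qed.

End Over.
End Flip.

(** * Every point over a field or a local ring lies in a chart *)

Section Exists.
Variables (K : fieldType) (n m : nat) (D : frame_data K n m).
Variables (Q w : 'M[K]_m).
Hypothesis lamD : forall i j, flam D 0 i + flam D 0 j != 0.
Hypothesis lamB : forall i j, i != j -> flam D 0 i - flam D 0 j != 0.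
Hypothesis frD : is_frame Q w D.
Implicit Types (J : {set 'I_n}).

(** Pairing with [fF] under [Q] reads off the coordinates along [fE]. *)
Definition coordF (B : comNzRingType) (iota : {rmorphism K -> B}) J : 'M[B]_(m, n) :=
  map_mx iota Q *m (map_mx iota (fF (flip D J)))^T.
Definition coorde (B : comNzRingType) (iota : {rmorphism K -> B}) : 'M[B]_(m, 1) :=
  map_mx iota Q *m (map_mx iota (fe D))^T.

(* If J maximises the rank and v in the row space of P has vanishing chart
   coordinates, then v lies in the span of the f_k; flipping an i with nonzero
   f_i-coordinate of v would increase the rank. *)
Lemma field_chart (F : fieldType) (iota : {rmorphism K -> F}) (P : 'M[F]_m) :
  P *m map_mx iota Q *m P^T = 0 -> \rank P = n ->
  exists J, \rank (P *m coordF iota J) = n.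
Proof.
move=> PQ rkP; pose r J := \rank (P *m coordF iota J).
have [J _ maxJ] := @arg_maxnP _ set0 predT r isT.
exists J; apply/eqP; rewrite eqn_leq rank_leq_col leqNgt; apply/negP => ltn.
have frJ J' := frame_map iota (flip_frame lamD lamB J' frD).
have /rowV0Pn[v] : (P :&: kermx (coordF iota J))%MS != 0.
  rewrite -mxrank_eq0 -lt0n -(ltn_add2l (r J)) addn0 mxrank_mul_ker.
  by rewrite rkP.
rewrite sub_capmx => /andP[/submxP[c Ev] /sub_kermxP vF] v0.
have vQ (u : 'rV_m) : (u <= P)%MS -> u *m map_mx iota Q *m v^T = 0.
  move=> /submxP[d ->]; rewrite Ev trmx_mul !mulmxA -2!(mulmxA d) PQ.
  by rewrite mulmx0 mul0mx.
have Pv : (v <= P)%MS by rewrite Ev submxMl.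
have := frame_expand (frJ J) v; rewrite -(mulmxA v) -/(coordF iota J) vF mul0mx.
rewrite add0r; set z := _ *m _ *m (fe _)^T; set y := _ *m _ *m (fE _)^T => vzy.
(* Here v = z e + (combination of the f_k), so isotropy of [v] reads z^2 = 0. *)
have z0 : z = 0.
  have vT : v^T = (fe (map_frame iota (flip D J)))^T *m z^T
      + (fF (map_frame iota (flip D J)))^T *m y^T.
    by rewrite {1}vzy -!trmx_mul; apply: raddfD.
  have := vQ v Pv; rewrite vT mulmxDr !mulmxA -/z.
  rewrite -(mulmxA v _ (fF _)^T) -/(coordF iota J) vF mul0mx addr0.
  rewrite [z]mx11_scalar tr_scalar_mx -scalar_mxM => /matrixP/(_ 0 0).
  by rewrite !mxE eqxx => /eqP; rewrite mulf_eq0 orbb => /eqP ->; rewrite raddf0.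
rewrite z0 mul0mx add0r in vzy.
have [i yi] : exists i, y 0 i != 0.
  apply/existsP; rewrite -negb_forall; apply: contraNN v0 => /forallP y0.
  rewrite vzy; suff -> : y = 0 by rewrite mul0mx.
  by apply/rowP => i; rewrite [RHS]mxE; apply/eqP.
pose J' := toggle J i.
have vJ' : (v *m coordF iota J') 0 i = y 0 i.
  rewrite mulmxA mulmx_tr_row -map_row /= rowK toggleE eqxx /=.
  rewrite [RHS]mulmx_tr_row -map_row /= rowK.
  by case: (i \in J).
(* The coordinates for J and J' agree off [i], and the remaining one for J, multiplied by y_i, is
   Q(u, v) = 0. The inclusion is strict because [v] is lost, so J' would have larger rank. *)
have sub : (P :&: kermx (coordF iota J') <= P :&: kermx (coordF iota J))%MS.
  apply/rV_subP => u; rewrite !sub_capmx => /andP[uP /sub_kermxP uJ'].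
  rewrite uP /=; apply/sub_kermxP.
  have uJ l : l != i -> (u *m coordF iota J) 0 l = 0.
    move=> /negPf li; transitivity ((u *m coordF iota J') 0 l); last first.
      by rewrite uJ' mxE.
    rewrite /coordF !mulmxA mulmx_tr_row [RHS]mulmx_tr_row -!map_row /= !rowK.
    by rewrite toggleE li.
  apply/rowP => l; rewrite [RHS]mxE.
  have [->|li] := eqVneq l i; last exact: uJ.
  have := vQ u uP; rewrite vzy trmx_mul mulmxA -(mulmxA u) -/(coordF iota J).
  move/matrixP/(_ 0 0); rewrite mxE [RHS]mxE (bigD1 i) //= big1 ?addr0.
    by rewrite [y^T _ _]mxE => /eqP; rewrite mulf_eq0 (negPf yi) orbF => /eqP.
  by move=> k ki; rewrite uJ // mul0r.
have /rank_ltmx ltr :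
    (P :&: kermx (coordF iota J') < P :&: kermx (coordF iota J))%MS.
  rewrite /ltmx sub /=; apply/negP => sub'.
  have : (v <= P :&: kermx (coordF iota J'))%MS.
    by apply: submx_trans sub'; rewrite sub_capmx Pv; apply/sub_kermxP.
  rewrite sub_capmx => /andP[_ /sub_kermxP E].
  by move: yi; rewrite -vJ' E mxE eqxx.
have : (r J' <= r J)%N by apply: maxJ.
rewrite leqNgt => /negP; apply.
rewrite -(ltn_add2r (\rank (P :&: kermx (coordF iota J')))) mxrank_mul_ker.
by rewrite -(mxrank_mul_ker P (coordF iota J)) ltn_add2l.
Qed.

(** A chart over the residue field comes with a nonzero n by n minor of coordinates, on the rows
    chosen by [c]; over a local ring this minor is invertible. *)
Lemma local_chart (B : comNzRingType) (iota : {rmorphism K -> B})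
    (L : 'rV[B]_m -> Prop) (P : 'M[B]_m) :
  local_ring B -> (forall (F : fieldType) (h : {rmorphism B -> F}),
    \rank (map_mx h P) = n) -> P *m map_mx iota Q *m P^T = 0 ->
  exists J (c : {ffun 'I_n -> 'I_m}),
    invertible (\det (rowsub c (P *m coordF iota J))).
Proof.
move=> locB rkP PQ; have [F [h hP]] := residue_field locB.
have [|J rkJ] := @field_chart F (h \o iota) (map_mx h P) _ (rkP F h).
  by rewrite (map_mx_comp iota h) map_trmx -!map_mxM PQ map_mx0.
have full : row_full (map_mx h (P *m coordF iota J)).
  apply/eqP; rewrite -[RHS]rkJ /coordF !(map_mx_comp iota h) !map_trmx.
  by rewrite -!map_mxM.
exists J, (fullrankfun full); apply: contrapT => /hP /eqP.
rewrite -det_map_mx map_mxsub; apply/negP; rewrite -unitfE -unitmxE.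
exact: fullrowsub_unit.
Qed.

(** The parameters are written by Cramer's rule with the determinant as sole denominator, so that
    numerators and denominator make sense before any localisation. *)
Lemma local_chart_span (B : comNzRingType) (iota : {rmorphism K -> B})
    (L : 'rV[B]_m -> Prop) (P : 'M[B]_m) J (c : 'I_n -> 'I_m) u :
  local_ring B -> P *m P = P -> (forall v, L v <-> v *m P = v) ->
  is_subbundle n L -> P *m map_mx iota Q *m P^T = 0 ->
  P *m map_mx iota w *m P^T = 0 ->
  \det (rowsub c (P *m coordF iota J)) * u = 1 ->
  forall v, L v <-> row_span (fchart D iota J
    (u *: (\adj (rowsub c (P *m coordF iota J)) *m rowsub c (P *m coorde iota)))) v.
Proof.
move=> locB PP LP subL PQ Pw du.
set C := rowsub c _; pose T := u *: (\adj C).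
have TC : T *m C = 1%:M.
  by rewrite -scalemxAl mul_adj_mx scale_scalar_mx mulrC du.
pose Y := T *m rowsub c P.
have YF : Y *m coordF iota J = 1%:M by rewrite -mulmxA mul_rowsub_mx.
have iso G : P *m G *m P^T = 0 -> Y *m G *m Y^T = 0.
  move=> PG; have EY : Y = T *m rowsub c 1%:M *m P.
    by rewrite -mulmxA mul_rowsub_mx mul1mx.
  by rewrite EY trmx_mul -!mulmxA (mulmxA P) (mulmxA (P *m G)) PG mul0mx !mulmx0.
have frJ := frame_map iota (flip_frame lamD lamB J frD).
have YY : Y = fchart D iota J (Y *m map_mx iota Q *m (map_mx iota (fe D))^T).
  by apply: (isotropic_chart frJ); rewrite ?iso // -mulmxA.
rewrite scalemxAl -/T -mul_rowsub_mx mulmxA -/Y /coorde mulmxA -YY.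
apply: (local_span locB subL) YF => i; apply/LP.
by rewrite -row_mul -mulmxA mul_rowsub_mx PP.
Qed.
End Exists.

Lemma line_rinv (A : comNzRingType) b (s x u : A) : s * u = 1 ->
  line b s x *m (u *: delta_mx (if b then 1 else ord0) 0) = 1%:M.
Proof.
move=> su; rewrite -scalemxAr -colE; apply/matrixP => i i'.
by rewrite !ord1 !mxE eqxx; case: b; rewrite /= mulrC.
Qed.

Lemma line_subbundle (A : comNzRingType) b (s x : A) :
  invertible s -> is_subbundle 1 (row_span (line b s x)).
Proof. by case=> u su; apply: span_subbundle (line_rinv b x su). Qed.

Lemma invertible_prod (A : comNzRingType) (I : finType) (x : I -> A) :
  (forall i, invertible (x i)) -> invertible (\prod_i x i).
Proof.
move=> ux; elim/big_ind: _ => //; first exact: invertible1.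
by move=> a b ? ?; apply/invertibleM.
Qed.

Lemma isotropicP (K : fieldType) m (G : 'M[K]_m) (A : comAlgType K)
    (L : 'rV[A]_m -> Prop) (P : 'M[A]_m) :
  P *m P = P -> (forall v, L v <-> v *m P = v) -> isotropic G L ->
  P *m map_mx (in_alg A) G *m P^T = 0.
Proof.
move=> PP LP iso; apply/matrixP => i j; rewrite bil_entry [RHS]mxE.
by apply: iso; apply/LP; rewrite -row_mul PP.
Qed.

(* The chart at a = t / s with denominators cleared. *)
Definition hchart (A : comNzRingType) n m (D : frame_data A n m) (s : A)
    (t : 'cV[A]_n) : 'M[A]_(n, m) :=
  s ^+ 2 *: fE D + s *: (t *m fe D) + chart_coef (fbeta D) t *m fF D.

Lemma hchart_scale (A : comNzRingType) n m (D : frame_data A n m) (s u : A) t :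
  s * u = 1 -> hchart D s t = s ^+ 2 *: chart D (u *: t).
Proof.
move=> su; rewrite /chart /hchart !scalerDr; congr (_ + _ + _).
  by rewrite -scalemxAl scalerA expr2 -mulrA su mulr1.
rewrite scalemxAl; congr (_ *m _); apply/matrixP => k j; rewrite !mxE.
transitivity (- (fbeta D k j * (t k 0 * t j 0)) * (s * u) ^+ 2); last by ring.
by rewrite su expr1n mulr1.
Qed.

Lemma hchart_span (A : comNzRingType) n m (D : frame_data A n m) (s u : A) t v :
  s * u = 1 -> row_span (hchart D s t) v <-> row_span (chart D (u *: t)) v.
Proof.
move=> su; rewrite (hchart_scale D t su); split.
  by apply: (@row_span_sub _ _ _ _ _ _ (s ^+ 2)%:M); rewrite mul_scalar_mx.
apply: (@row_span_sub _ _ _ _ _ _ (u ^+ 2)%:M).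
by rewrite mul_scalar_mx scalerA -exprMn [u * s]mulrC su expr1n scale1r.
Qed.

Lemma map_hchart (A B : comNzRingType) (f : {rmorphism A -> B}) n m
    (D : frame_data A n m) s t :
  map_mx f (hchart D s t) = hchart (map_frame f D) (f s) (map_mx f t).
Proof.
rewrite /hchart !map_mxD !map_mxZ !map_mxM rmorphXn; congr (_ + _ *m _).
by apply/matrixP => k j; rewrite !mxE rmorphN !rmorphM.
Qed.

(** * From local rings to arbitrary algebras *)

Section Global.
Variables (K : fieldType) (n m : nat) (D : frame_data K n m).
Variables (Q w : 'M[K]_m).
Hypothesis lamD : forall i j, flam D 0 i + flam D 0 j != 0.
Hypothesis lamB : forall i j, i != j -> flam D 0 i - flam D 0 j != 0.
Hypothesis two0 : (2 : K) != 0.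
Hypothesis frD : is_frame Q w D.

Definition scalars (A : comAlgType K) (B : comNzRingType)
  (f : {rmorphism A -> B}) : {rmorphism K -> B} := f \o in_alg A.

Lemma related_ext (B : comNzRingType) (iota iota' : {rmorphism K -> B})
    (L L' : 'rV[B]_m -> Prop) (y y' : 'I_n -> 'rV[B]_2 -> Prop) :
  iota =1 iota' -> (forall v, L v <-> L' v) -> (forall i v, y i v <-> y' i v) ->
  related D iota L y -> related D iota' L' y'.
Proof.
move=> E LL' yy' [J [a [La ya]]]; exists J, a; split=> [v|i v].
  by rewrite -LL' La /fchart (funext E).
by rewrite -yy' ya /fline E.
Qed.

(** All local rings over [A] are tested, not only its localisations: compatibility with base change
    is then composition of morphisms. *)
Definition globally_related (A : comAlgType K) (L : subbundle n m A)
    (y : 'I_n -> subbundle 1 2 A) : Prop :=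
  forall (B : comNzRingType) (f : {rmorphism A -> B}), local_ring B ->
  related D (scalars f) (extend f L) (fun i => extend f (y i)).

Lemma globally_related_fun (A : comAlgType K) (L : subbundle n m A) y y' :
  globally_related L y -> globally_related L y' -> y = y'.
Proof.
move=> Ly Ly'; apply: funext => i; apply: subbundle_local_eq => B f locB.
exact: (related_fun lamD lamB two0 frD (Ly B f locB) (Ly' B f locB)).
Qed.

Lemma globally_related_inj (A : comAlgType K) (L L' : subbundle n m A) y :
  globally_related L y -> globally_related L' y -> L = L'.
Proof.
move=> Ly Ly'; apply: subbundle_local_eq => B f locB.
exact: (related_inj lamD lamB two0 frD (Ly B f locB) (Ly' B f locB)).
Qed.

Lemma globally_related_base_change (A A' : comAlgType K)
    (g : {lrmorphism A -> A'}) (L : subbundle n m A) y :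
  globally_related L y ->
  globally_related (subbundle_base_change g L)
    (fun i => subbundle_base_change g (y i)).
Proof.
move=> Ly B f locB; apply: related_ext (Ly B (f \o g) locB).
- by move=> x /=; rewrite rmorph_alg.
- by move=> v; apply: extend_comp.
- by move=> i v; apply: extend_comp.
Qed.

(** Each subset and choice of rows gives candidate lines over [A]. Where two determinants are
    invertible, the candidates agree by [related_fun] applied to the one plane [L], so no transition
    formula is computed over [A]. *)
Lemma exists_lines (A : comAlgType K) (L : subbundle n m A) :
  isotropic Q L -> isotropic w L -> exists y, globally_related L y.
Proof.
case: (subbundleP L) => P [PP LP rkP] isoQ isow.
have PQ := isotropicP PP LP isoQ; have Pw := isotropicP PP LP isow.
pose I := ({set 'I_n} * {ffun 'I_n -> 'I_m})%type.
pose C (x : I) := rowsub x.2 (P *m coordF D Q (in_alg A) x.1).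
pose s x := \det (C x).
pose t x := \adj (C x) *m rowsub x.2 (P *m coorde D Q (in_alg A)).
(* Homogeneous form of the i-th line of the chart with parameters t / s. *)
pose N i (x : I) := line (i \in x.1) (s x) ((twist D x.1 i)%:A * t x i 0).
have mapF (B : comNzRingType) (f : {rmorphism A -> B}) J :
    map_mx f (P *m coordF D Q (in_alg A) J)
    = map_mx f P *m coordF D Q (scalars f) J.
  by rewrite /coordF !map_mxM -map_trmx -!map_mx_comp.
have mape (B : comNzRingType) (f : {rmorphism A -> B}) :
    map_mx f (P *m coorde D Q (in_alg A))
    = map_mx f P *m coorde D Q (scalars f).
  by rewrite /coorde !map_mxM -map_trmx -!map_mx_comp.
have isoP (B : comNzRingType) (f : {rmorphism A -> B}) G :
    P *m map_mx (in_alg A) G *m P^T = 0 ->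
    map_mx f P *m map_mx (scalars f) G *m (map_mx f P)^T = 0.
  move=> PG; rewrite /scalars (map_mx_comp (in_alg A) f) map_trmx -!map_mxM PG.
  by rewrite map_mx0.
have key (B : comNzRingType) (f : {rmorphism A -> B}) x : local_ring B ->
    invertible (f (s x)) -> related D (scalars f) (extend f L)
      (fun i => row_span (map_mx f (N i x))).
  move=> locB [u su]; exists x.1, (u *: map_mx f (t x)); split=> [|i] v.
    have := @local_chart_span K n m D Q w lamD lamB frD B (scalars f)
      (extend f L) (map_mx f P) x.1 x.2 u locB.
    rewrite -mapF -mape -!map_mxsub -map_mx_adj [map_mx f (t x)]map_mxM; apply=> //.
    - by rewrite -map_mxM PP.
    - exact: extend_projector.
    - exact: extend_subbundle.
    - exact: isoP.
    - exact: isoP.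
    by rewrite det_map_mx.
  rewrite map_line (line_scale _ _ _ su) /fline rmorphM !mxE.
  by rewrite mulrCA.
have /choice[y yP] i : exists y : subbundle 1 2 A,
    forall (B : comNzRingType) (f : {rmorphism A -> B}), local_ring B ->
    forall x, invertible (f (s x)) ->
    forall v, extend f y v <-> row_span (map_mx f (N i x)) v.
  apply: glue.
  - move=> B f locB.
    have [||J [c]] := @local_chart K n m D Q w lamD lamB frD B (scalars f)
      (extend f L) (map_mx f P) locB.
    + by move=> F h; rewrite -map_mx_comp; apply: (rkP F (h \o f)).
    + exact: isoP.
    by rewrite -mapF -map_mxsub det_map_mx; exists (J, c).
  - move=> B f locB x x' ux ux' v.
    by apply: (related_fun lamD lamB two0 frD (key B f x locB ux)
      (key B f x' locB ux') _ i v).1.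
  - by move=> B f locB x ux; rewrite map_line; apply: line_subbundle.
exists y => B f locB.
have [||J [c]] := @local_chart K n m D Q w lamD lamB frD B (scalars f)
      (extend f L) (map_mx f P) locB.
+ by move=> F h; rewrite -map_mx_comp; apply: (rkP F (h \o f)).
+ exact: isoP.
rewrite -mapF -map_mxsub det_map_mx => ux.
apply: related_ext (key B f (J, c) locB ux) => // i v.
by rewrite (yP i B f locB (J, c)).
Qed.

(** Where one entry of each projector [p i] is invertible, its row generates the i-th line and
    yields the chart parameter. The resulting planes agree on overlaps by [related_inj]. *)
Lemma exists_isotropic (A : comAlgType K) (y : 'I_n -> subbundle 1 2 A) :
  exists L : subbundle n m A,
    [/\ isotropic Q L, isotropic w L & globally_related L y].
Proof.
have /choice[p pP] i := subbundleP (y i).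
pose I := ({set 'I_n} * {ffun 'I_n -> 'I_2})%type.
pose pos (b : bool) : 'I_2 := if b then ord0 else 1.
pose den (x : I) i : A := p i (x.2 i) (pos (i \notin x.1)).
pose num (x : I) i : A := p i (x.2 i) (pos (i \in x.1)).
have rowp (x : I) i : row (x.2 i) (p i) = line (i \in x.1) (den x i) (num x i).
  apply/rowP => j; rewrite !mxE /den /num.
  by case: (i \in x.1); case: j => -[|[|//]] hj //=; congr (p i _ _);
    apply: val_inj.
pose s (x : I) := \prod_i den x i.
(* The quotients t / s are the num_i / den_i divided by [twist], brought to the common denominator
   [s]. *)
pose t (x : I) : 'cV[A]_n := \col_i ((twist D x.1 i)^-1%:A *
  (num x i * \prod_(l | l != i) den x l)).
pose N (x : I) := hchart (map_frame (in_alg A) (flip D x.1)) (s x) (t x).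
have mapN (B : comNzRingType) (f : {rmorphism A -> B}) x : map_mx f (N x)
    = hchart (map_frame (scalars f) (flip D x.1)) (f (s x)) (map_mx f (t x)).
  rewrite map_hchart; congr hchart; rewrite /map_frame /=.
  by rewrite -!map_mx_comp.
have frJ (B : comNzRingType) (f : {rmorphism A -> B}) J :=
  frame_map (scalars f) (flip_frame lamD lamB J frD).
have key (B : comNzRingType) (f : {rmorphism A -> B}) x : local_ring B ->
    invertible (f (s x)) -> related D (scalars f) (row_span (map_mx f (N x)))
      (fun i => extend f (y i)).
  move=> locB [u su]; exists x.1, (u *: map_mx f (t x)); split=> [v|i v].
    by rewrite mapN (hchart_span _ _ _ su).
  have [pp yp rkp] := pP i.
  have du : f (den x i) * (u * f (\prod_(l | l != i) den x l)) = 1.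
    by rewrite -[RHS]su /s [in RHS](bigD1 i) //= rmorphM; ring.
  have -> : fline D (scalars f) x.1 (u *: map_mx f (t x)) i
      = line (i \in x.1) 1 (u * f (\prod_(l | l != i) den x l) * f (num x i)).
    rewrite /fline; congr line.
    have -> : (u *: map_mx f (t x)) i 0 = u * (f (twist D x.1 i)^-1%:A *
        (f (num x i) * f (\prod_(l | l != i) den x l))).
      by rewrite !mxE !rmorphM.
    have tw : f ((twist D x.1 i)%:A) * f ((twist D x.1 i)^-1%:A) = 1.
      transitivity (f (in_alg A (twist D x.1 i * (twist D x.1 i)^-1))).
        by rewrite rmorphM /= rmorphM.
      by rewrite mulfV ?rmorph1 // twist_neq0.
    rewrite -[RHS]mul1r -tw /=; ring.
  rewrite -(line_scale _ _ _ du).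
  apply: (local_span locB (extend_subbundle f (y i)) _
    (line_rinv (i \in x.1) (f (num x i)) du)) => j.
  rewrite ord1 row_id -map_line -rowp; apply: extend_in.
  by apply/yp; rewrite -row_mul pp.
have cover (B : comNzRingType) (f : {rmorphism A -> B}) : local_ring B ->
    exists x, invertible (f (s x)).
  move=> locB; have [F [h hP]] := residue_field locB.
  have /choice[c cP] i : exists c : 'I_2 * 'I_2, invertible (f (p i c.1 c.2)).
    have [_ _ rkp] := pP i; apply: contrapT => no.
    suff p0 : map_mx (h \o f) (p i) = 0.
      by have := rkp F (h \o f); rewrite p0 mxrank0.
    apply/matrixP => a b; rewrite !mxE; apply/hP => ab; apply: no.
    by exists (a, b).
  (* The subset is chosen so that [den] picks the invertible entry of each projector. *)
  exists ([set i | (c i).2 != ord0], [ffun i => (c i).1]).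
  rewrite /s rmorph_prod; apply: invertible_prod => i; rewrite /den /= ffunE inE.
  have := cP i; congr (invertible (f (p i _ _))).
  by case: (c i).2 => -[|[|//]] hj; apply: val_inj.
have subb (B : comNzRingType) (f : {rmorphism A -> B}) x :
    invertible (f (s x)) -> is_subbundle n (row_span (map_mx f (N x))).
  case=> u su; rewrite mapN.
  apply: (is_subbundle_ext (fun v => iff_sym (hchart_span _ _ v su))).
  have := chartF (frJ B f x.1) (u *: map_mx f (t x)).
  by rewrite -mulmxA; apply: span_subbundle.
have [||L LP] := @glue A n m n I s N cover.
- move=> B f locB x x' ux ux' v.
  exact: (related_inj lamD lamB two0 frD (key B f x locB ux)
    (key B f x' locB ux') (fun _ _ => iff_refl _) v).1.
- by move=> B f locB x; apply: subb.
have Ly : globally_related L y.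
  move=> B f locB; have [x ux] := cover B f locB.
  apply: related_ext (key B f x locB ux) => // v.
  by rewrite (LP B f locB x).
(* Vanishing of the form on two vectors of [L] is an equation in [A], so it can be checked in charts
   over local rings. *)
have iso G : (forall (B : comNzRingType) (f : {rmorphism A -> B}) J a,
    fchart D (scalars f) J a *m map_mx (scalars f) G
      *m (fchart D (scalars f) J a)^T = 0) -> isotropic G L.
  move=> chG u v Lu Lv; apply: local_eq => B f locB.
  have [J [a [La _]]] := Ly B f locB.
  have /La[c Ec] := extend_in f Lu; have /La[d Ed] := extend_in f Lv.
  transitivity (map_mx f (u *m map_mx (in_alg A) G *m v^T) 0 0).
    by rewrite mxE.
  rewrite !map_mxM -map_trmx -map_mx_comp Ec Ed trmx_mul rmorph0.
  by rewrite -!mulmxA (mulmxA (fchart _ _ _ _)) (mulmxA (_ *m _) _ d^T) chG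
    mul0mx mulmx0 mxE.
exists L; split=> //; apply: iso => B f J a.
  exact: chart_isotropicQ (frJ B f J) _.
exact: chart_isotropicw (frJ B f J) _.
Qed.
End Global.

Lemma zero_locus_isomorphic (K : fieldType) n (Q w : 'M[K]_(2 * n + 1))
    (D : frame_data K n (2 * n + 1)) :
  (forall i j, flam D 0 i + flam D 0 j != 0) ->
  (forall i j, i != j -> flam D 0 i - flam D 0 j != 0) ->
  (2 : K) != 0 -> is_frame Q w D ->
  isomorphic (zero_locus Q w) (power (P1 K) n).
Proof.
move=> lamD lamB two0 frD.
have to (A : comAlgType K) (x : zero_locus Q w A) :
    {y : power (P1 K) n A | globally_related D (sval (sval x)) y}.
  by apply: cid; apply: (exists_lines lamD lamB two0 frD (svalP (sval x)) (svalP x)).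
have from (A : comAlgType K) (y : power (P1 K) n A) :
    {x : zero_locus Q w A | globally_related D (sval (sval x)) y}.
  apply: cid; have [L [LQ Lw Ly]] := exists_isotropic lamD lamB two0 frD y.
  by exists (exist _ (exist _ L LQ) Lw).
have valE (A : comAlgType K) (x x' : zero_locus Q w A) :
    sval (sval x) = sval (sval x') -> x = x'.
  by case: x x' => [[L ?] ?] [[L' ?] ?] /= E; do 2 apply: eq_exist.
exists (fun A x => sval (to A x)); split=> [A|A B f x].
  exists (fun y => sval (from A y)) => [x|y].
    apply: valE.
    exact: (globally_related_inj lamD lamB two0 frD
      (svalP (from A _)) (svalP (to A x))).
  exact: (globally_related_fun lamD lamB two0 frD
    (svalP (to A _)) (svalP (from A y))).
apply: (globally_related_fun lamD lamB two0 frD (svalP (to B _))).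
exact: (globally_related_base_change f (svalP (to A x))).
Qed.

(** * Simultaneous normal form of the two forms *)

(** For sizes that are equal without being convertible, such as n + n + 1 and m. *)
Lemma mulmx1C_eq (R : comNzRingType) m p (A : 'M[R]_(p, m)) (B : 'M[R]_(m, p)) :
  p = m -> A *m B = 1%:M -> B *m A = 1%:M.
Proof. by move=> pm; case: _ / pm A B => A B; apply: mulmx1C. Qed.

Section Congruence.
Variable K : numClosedFieldType.

(** Polarisation: if all Q(v, v) vanish, the value at the sum of two basis vectors is 2 Q_ij. *)
Lemma sym_nonisotropic m (Q : 'M[K]_m) : Q^T = Q -> Q != 0 ->
  exists v : 'rV_m, (v *m Q *m v^T) 0 0 != 0.
Proof.
move=> sQ; apply: contraNP => no; apply/eqP/matrixP => i j; rewrite [RHS]mxE.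
have v0 (v : 'rV_m) : (v *m Q *m v^T) 0 0 = 0.
  by apply/eqP; apply: contraT => vv; exfalso; apply: no; exists v.
have E k l : ((delta_mx 0 k : 'rV_m) *m Q *m (delta_mx 0 l : 'rV_m)^T) 0 0 = Q k l.
  by rewrite -rowE trmx_delta -colE !mxE.
have := v0 (delta_mx 0 i + delta_mx 0 j).
have := v0 (delta_mx 0 i); have := v0 (delta_mx 0 j).
have addE (X Y : 'M[K]_1) : (X + Y) 0 0 = X 0 0 + Y 0 0 by rewrite mxE.
rewrite linearD !mulmxDl !mulmxDr !addE !E => -> ->.
have -> : Q j i = Q i j by rewrite -{1}sQ mxE.
rewrite add0r addr0 -mulr2n => /eqP; rewrite mulrn_eq0 /= => /eqP.
exact.
Qed.

Lemma extend_row m (v : 'rV[K]_m.+1) : v != 0 ->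
  exists2 H, H \in unitmx & exists2 c, c != 0 & v = c *: row 0 H.
Proof.
move=> v0; exists (row_ebase v); first exact: row_ebase_unit.
have rk : \rank v = 1%N by rewrite rank_rV v0.
exists (col_ebase v 0 0).
  have := col_ebase_unit v; rewrite unitmxE unitfE.
  by rewrite {1}[col_ebase v]mx11_scalar det_scalar1.
rewrite -[LHS]mulmx_ebase rk [col_ebase v]mx11_scalar.
rewrite -mulmxA mul_scalar_mx [in RHS]mxE eqxx mulr1n; congr (_ *: _).
apply/rowP => j; rewrite !mxE (bigD1 0) //= big1 => [|k k0]; rewrite !mxE //=.
  by rewrite mul1r addr0.
have /negPf kN : (k : nat) != 0%N by [].
by rewrite eq_sym kN mul0r.
Qed.

(** Lagrange reduction: a non-isotropic vector is split off, normalised by a square root, and the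
    induction continues on the Schur complement [C']. *)
Lemma sym_congruent m (Q : 'M[K]_m) : Q^T = Q -> Q \in unitmx ->
  exists2 H, H \in unitmx & H *m Q *m H^T = 1%:M.
Proof.
elim: m => [|m IH] in Q *.
  by move=> _ _; exists 1%:M; [exact: unitmx1 | by apply/matrixP => -[]].
move=> sQ uQ; have Q0 : Q != 0.
  by apply: contraTneq uQ => ->; rewrite unitmxE det0 unitr0.
have [v vQ] := sym_nonisotropic sQ Q0.
have v0 : v != 0 by apply: contraNneq vQ => ->; rewrite !mul0mx mxE.
have [H1 uH1 [c c0 Ev]] := extend_row v0.
have [R ER] : {R : 'M_(1 + m) | H1 *m Q *m H1^T = R} by eexists.
have sR : R^T = R by rewrite -ER !trmx_mul trmxK sQ mulmxA.
have uR : R \in unitmx by rewrite -ER !unitmx_mul unitmx_tr uH1 uQ.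
pose a := ulsubmx R; pose b := ursubmx R; pose C := drsubmx R.
have RE : R = block_mx a b b^T C.
  by rewrite -[LHS]submxK /b trmx_ursub sR.
have aT : a = (a 0 0)%:M by apply: mx11_scalar.
have a0 : a 0 0 != 0.
  apply: contraNneq vQ => R0.
  have -> : v *m Q *m v^T = c *: (c *: (row 0 H1 *m Q *m (row 0 H1)^T)).
    by rewrite {1 2}Ev linearZ /= -scalemxAr -!scalemxAl.
  have scE x (X : 'M[K]_1) : (x *: X) 0 0 = x * X 0 0 by rewrite mxE.
  rewrite !scE -bil_entry ER.
  have -> : R 0 0 = a 0 0.
    transitivity (block_mx a b b^T C (lshift m 0) (lshift m 0)).
      by rewrite -RE; congr (R _ _); apply: val_inj.
    by rewrite block_mxEul.
  by rewrite R0 !mulr0.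
move: (a 0 0) aT a0 => al aT al0.
pose s := (sqrtC al)^-1.
pose L : 'M_(1 + m) := block_mx 1%:M 0 (- al^-1 *: b^T) 1%:M.
pose C' := C - al^-1 *: (b^T *m b).
have LR : L *m R *m L^T = block_mx a 0 0 C'.
  have ba : (- al^-1 *: b^T) *m a = - b^T.
    by rewrite aT mul_mx_scalar scalerA mulrN mulfV // scaleN1r.
  have ab : a *m (- al^-1 *: b) = - b.
    by rewrite aT mul_scalar_mx scalerA mulrN mulfV // scaleN1r.
  have LT : L^T = block_mx 1%:M (- al^-1 *: b) 0 1%:M.
    by rewrite /L tr_block_mx !trmx1 !trmx0 [(_ *: _)^T]linearZ /= trmxK.
  rewrite LT RE mulmx_block !mul1mx !mul0mx !addr0 ba addNr.
  rewrite mulmx_block !mulmx1 !mulmx0 !mul0mx !addr0 ab addNr !add0r.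
  by rewrite -scalemxAl scaleNr addrC.
have uL : L \in unitmx by rewrite unitmxE det_lblock !det1 mulr1 unitr1.
have sC' : C'^T = C'.
  have : (L *m R *m L^T)^T = L *m R *m L^T by rewrite !trmx_mul trmxK sR mulmxA.
  by rewrite LR tr_block_mx => /eq_block_mx[_ _ _].
have uC' : C' \in unitmx.
  have : L *m R *m L^T \in unitmx by rewrite !unitmx_mul unitmx_tr uL uR.
  by rewrite LR !unitmxE det_ublock unitrM => /andP[].
have [H' uH' H'C] := IH C' sC' uC'.
pose M : 'M_(1 + m) := block_mx s%:M 0 0 H'.
have uM : M \in unitmx.
  rewrite unitmxE det_ublock det_scalar1 unitrM.
  by rewrite -(unitmxE H') uH' andbT unitfE invr_eq0 sqrtC_eq0.
exists (M *m L *m H1); first by rewrite !unitmx_mul uM uL uH1.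
transitivity (M *m (L *m R *m L^T) *m M^T).
  by rewrite -ER !trmx_mul !mulmxA.
rewrite LR /M tr_block_mx !mulmx_block !trmx0 !mulmx0 !mul0mx !addr0 !add0r.
rewrite H'C aT tr_scalar_mx -!scalar_mxM.
have -> : s * al * s = 1.
  by rewrite /s -{2}(sqrtCK al) expr2; field; rewrite sqrtC_eq0.
by rewrite !mul0mx; apply/esym/(@scalar_mx_block _ 1 m).
Qed.
End Congruence.

(** * Separable characteristic polynomials and diagonalisation *)

Lemma similar_char_poly (F : fieldType) m (V A B : 'M[F]_m) : V \in unitmx ->
  V *m A = B *m V -> char_poly A = char_poly B.
Proof.
move=> uV VA; pose V' := map_mx polyC V.
have V0 : \det V' != 0.
  by rewrite det_map_mx polyC_eq0 -unitfE -unitmxE.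
apply: (mulfI V0); rewrite [RHS]mulrC -!det_mulmx; congr (\det _).
rewrite /char_poly_mx mulmxBr mulmxBl -scalar_mxC; congr (_ - _).
by rewrite -!map_mxM VA.
Qed.

Lemma char_poly_diag (F : fieldType) m (d : 'rV[F]_m) :
  char_poly (diag_mx d) = \prod_(x <- [seq d 0 i | i <- enum 'I_m]) ('X - x%:P).
Proof.
rewrite char_poly_trig ?diag_mx_is_trig // big_map big_enum /=.
by apply: eq_bigr => i _; rewrite mxE eqxx.
Qed.

Lemma separable_diag (F : fieldType) m (d : 'rV[F]_m) :
  separable_poly (char_poly (diag_mx d)) <-> injective (d 0).
Proof.
rewrite char_poly_diag separable_prod_XsubC.
by split=> /injectiveP.
Qed.

(* Up to sign, the discriminant of the characteristic polynomial. *)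
Definition disc_mx (R : comNzRingType) m (T : 'M[R]_m.+1) : R :=
  \det (horner_mx T (char_poly T)^`()).

Lemma map_disc_mx (R S : comNzRingType) (f : {rmorphism R -> S}) m
    (T : 'M[R]_m.+1) : f (disc_mx T) = disc_mx (map_mx f T).
Proof.
by rewrite /disc_mx -det_map_mx map_horner_mx -deriv_map map_char_poly.
Qed.

(** An eigenvector for a common root of p and p' is killed by p'(T). Conversely a Bezout relation u
    p + v p' = 1, evaluated at T, makes p'(T) invertible by Cayley-Hamilton. *)
Lemma disc_mx_separable (F : closedFieldType) m (T : 'M[F]_m.+1) :
  disc_mx T != 0 <-> separable_poly (char_poly T).
Proof.
split=> [d0|].
  rewrite separable_poly.unlock /coprimep; apply: contraT => /closed_rootP[z].
  rewrite root_gcd => /andP[]; rewrite -eigenvalue_root_char.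
  move=> /eigenvalueP[v vT v0] /factor_theorem[q Eq].
  have vd : v *m horner_mx T (char_poly T)^`() = 0.
    rewrite Eq mulrC rmorphM /= rmorphB /= horner_mx_X horner_mx_C.
    by rewrite -[_ * _]/(_ *m _) mulmxA mulmxBr vT mul_mx_scalar subrr mul0mx.
  exfalso; move: d0 v0; rewrite -unitfE -unitmxE => ud /eqP; apply.
  by rewrite -[v](mulmxK ud) vd mul0mx.
rewrite separable_poly.unlock => /Bezout_eq1_coprimepP[[u v] /= E].
apply/eqP => d0; have := congr1 (horner_mx T) E.
rewrite rmorphD !rmorphM /= Cayley_Hamilton mulr0 add0r rmorph1.
move=> /(congr1 (fun M : 'M_m.+1 => \det M)); rewrite -[_ * _]/(_ *m _).
by rewrite det_mulmx -/(disc_mx T) d0 mulr0 det1 => /eqP; rewrite eq_sym oner_eq0.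
Qed.

Lemma separable_diagonalizable (F : closedFieldType) m (T : 'M[F]_m.+1) :
  separable_poly (char_poly T) ->
  exists2 V, V \in unitmx &
    exists2 d : 'rV_m.+1, injective (d 0) & V *m T = diag_mx d *m V.
Proof.
move=> sep; have [r Er] := closed_field_poly_normal (char_poly T).
rewrite (monicP (char_poly_monic T)) scale1r in Er.
have [V uV /diagonalizable_forPex[d /(simmxP uV) Vd]] : diagonalizable T.
  apply/diagonalizableP; exists r; last by rewrite -Er mxminpoly_dvd_char.
  by rewrite -separable_prod_XsubC -Er.
exists V => //; exists d => //; apply/separable_diag.
by rewrite -(similar_char_poly uV Vd).
Qed.

(** * A form with distinct eigenvalues, and frames from eigenbases *)

Section GeneralForm.
Variables (K : numClosedFieldType).

(* Q0 is antidiagonal and d_i = i - n, so that d_i + d_j = 0 whenever the entry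
   (i, j) of Q0 is nonzero. *)
Lemma exists_antidiagonal n m : m = (2 * n + 1)%N ->
  exists (Q0 : 'M[K]_m) (d : 'rV[K]_m), [/\ Q0^T = Q0, Q0 \in unitmx,
    (diag_mx d *m Q0)^T = - (diag_mx d *m Q0) & injective (d 0)].
Proof.
move=> Em; pose Q0 : 'M[K]_m := \matrix_(i, j) (i == rev_ord j)%:R.
have revE (i j : 'I_m) : (i == rev_ord j) = (j == rev_ord i).
  by apply/eqP/eqP => ->; rewrite rev_ordK.
exists Q0, (\row_i (i%:R - n%:R)); split.
- by apply/matrixP => i j; rewrite !mxE revE.
- have QQ : Q0 *m Q0 = 1%:M.
    apply/matrixP => i j; rewrite !mxE (bigD1 (rev_ord i)) //= big1.
      by rewrite !mxE rev_ordK eqxx mul1r addr0 (inj_eq rev_ord_inj).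
    move=> k ki; rewrite !mxE revE (negPf ki) mul0r //.
  by case: (mulmx1_unit QQ).
- rewrite mul_diag_mx; apply/matrixP => i j; rewrite !mxE [i == _]revE.
  have [->|_] := eqVneq j (rev_ord i); last by rewrite /= !mulr0 oppr0.
  rewrite /= !mulr1 opprB; apply/eqP; rewrite subr_eq addrAC eq_sym subr_eq -!natrD.
  apply/eqP; congr (_%:R); have := ltn_ord i; lia.
- move=> i j; rewrite !mxE => /addIr /eqP; rewrite eqr_nat => /eqP; exact: val_inj.
Qed.

(** With Q = S Q0 S^T and w = S diag(d) Q0 S^T, the operator w Q^-1 is S diag(d) S^-1. *)
Lemma exists_separable n m (Q : 'M[K]_m.+1) : m.+1 = (2 * n + 1)%N ->
  Q^T = Q -> Q \in unitmx -> exists2 w : 'M[K]_m.+1, w^T = - w &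
  separable_poly (char_poly (w *m invmx Q)).
Proof.
move=> Em sQ uQ; have [Q0 [d [sQ0 uQ0 sd dI]]] := exists_antidiagonal Em.
have [H uH HQ] := sym_congruent sQ uQ.
have [H0 uH0 HQ0] := sym_congruent sQ0 uQ0.
pose S := invmx H *m H0.
have uS : S \in unitmx by rewrite unitmx_mul unitmx_inv uH.
have QE : Q = S *m Q0 *m S^T.
  have -> : S *m Q0 *m S^T = invmx H *m (H0 *m Q0 *m H0^T) *m (invmx H)^T.
    by rewrite /S trmx_mul !mulmxA.
  rewrite HQ0 -HQ !mulmxA mulVmx // mul1mx -mulmxA trmx_inv.
  by rewrite mulmxV ?unitmx_tr // mulmx1.
clearbody S; exists (S *m (diag_mx d *m Q0) *m S^T).
  by rewrite trmx_mul [(S *m _)^T]trmx_mul trmxK sd mulNmx mulmxN mulmxA.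
rewrite (@similar_char_poly _ _ (invmx S) _ (diag_mx d)) ?unitmx_inv //.
  exact/separable_diag.
have -> : S *m (diag_mx d *m Q0) *m S^T = S *m diag_mx d *m invmx S *m Q.
  by rewrite QE -!mulmxA mulKmx.
by rewrite mulmxK // !mulmxA mulVmx // mul1mx.
Qed.

(* The Gram matrix of an eigenbasis can be nonzero only at pairs of opposite
   eigenvalues, so it pairs i with a unique si i; the dimension being odd, exactly
   one i is paired with itself. *)
Lemma eigenbasis_frame n m (Q w V : 'M[K]_m) (d : 'rV[K]_m) :
  m = (2 * n + 1)%N -> Q^T = Q -> Q \in unitmx -> w^T = - w -> V \in unitmx ->
  V *m w = diag_mx d *m V *m Q -> injective (d 0) ->
  exists D : frame_data K n m, [/\ is_frame Q w D,
    forall i j, flam D 0 i + flam D 0 j != 0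
  & forall i j, i != j -> flam D 0 i - flam D 0 j != 0].
Proof.
move=> Em sQ uQ sw uV Vw dI.
pose G := V *m Q *m V^T.
have GE i j : (row i V *m Q *m (row j V)^T) 0 0 = G i j by rewrite -bil_entry.
have WE i j : (row i V *m w *m (row j V)^T) 0 0 = d 0 i * G i j.
  by rewrite -bil_entry Vw -2!mulmxA mul_diag_mx [LHS]mxE ?mulmxA.
have sG i j : G j i = G i j.
  by rewrite -[in LHS](_ : G^T = G) ?mxE // /G !trmx_mul trmxK sQ mulmxA.
(* The matrix d_i G_ij of [w] in the eigenbasis is skew while [G] is symmetric. *)
have dG i j : (d 0 i + d 0 j) * G i j = 0.
  rewrite mulrDl -WE -(sG i j) -WE -!bil_entry.
  have -> : (V *m w *m V^T) j i = - (V *m w *m V^T) i j.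
    have : (V *m w *m V^T)^T = - (V *m w *m V^T).
      by rewrite !trmx_mul trmxK sw mulNmx mulmxN mulmxA.
    by move/matrixP/(_ i j); rewrite mxE [RHS]mxE.
  by rewrite addrN.
have uG : G \in unitmx by rewrite !unitmx_mul unitmx_tr uV uQ.
have /choice[si siP] i : exists j, G i j != 0.
  apply/existsP; rewrite -negb_forall; apply/negP => /forallP G0.
  have : row i G *m invmx G = 0.
    suff -> : row i G = 0 by rewrite mul0mx.
    by apply/rowP => j; rewrite mxE [RHS]mxE; apply/eqP.
  rewrite -row_mul mulmxV // => /rowP/(_ i)/eqP.
  by rewrite !mxE eqxx oner_eq0.
have dsi i : d 0 (si i) = - d 0 i.
  have /eqP := dG i (si i); rewrite mulf_eq0 (negPf (siP i)) orbF.
  by rewrite addrC addr_eq0 => /eqP.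
have G0 i j : j != si i -> G i j = 0.
  move=> ji; have /eqP := dG i j; rewrite mulf_eq0 => /orP[|/eqP //].
  rewrite addrC addr_eq0 -dsi => /eqP /dI E; by rewrite E eqxx in ji.
have siK i : si (si i) = i by apply: dI; rewrite !dsi opprK.
(* [S] selects one index from each pair of opposite eigenvalues: these give the e_k, and their
   partners the f_k. *)
pose S := [set i : 'I_m | (i < si i)%N]; pose X := [set i : 'I_m | si i == i].
have cardS : #|S| = n /\ exists i0, si i0 = i0.
  have SiS : [set i : 'I_m | (si i < i)%N] = si @: S.
    apply/setP => i; rewrite inE; apply/idP/imsetP => [h|[j + ->]].
      by exists (si i); rewrite ?inE siK.
    by rewrite inE siK.
  have X1 : (#|X| <= 1)%N.
    have X0 i : i \in X -> d 0 i = 0.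
      rewrite inE => /eqP E; have := dsi i; rewrite E => /eqP.
      by rewrite -addr_eq0 -mulr2n mulrn_eq0 /= => /eqP.
    apply/card_le1P => i iX j; rewrite [in RHS]inE.
    by apply/idP/eqP => [jX|-> //]; apply: dI; rewrite !X0.
  have cardm : (#|S| + #|S| + #|X| = m)%N.
    have cSi : #|[set i : 'I_m | (si i < i)%N]| = #|S|.
      by rewrite SiS card_imset //; apply: can_inj siK.
    rewrite -[RHS]card_ord -cardsT.
    have -> : [set: 'I_m] = S :|: [set i : 'I_m | (si i < i)%N] :|: X.
      apply/setP => i; rewrite !inE; symmetry; rewrite -val_eqE /=.
      by case: ltngtP.
    rewrite !cardsU.
    have -> : S :&: [set i : 'I_m | (si i < i)%N] = set0.
      by apply/setP => i; rewrite !inE; case: ltngtP.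
    have -> : (S :|: [set i : 'I_m | (si i < i)%N]) :&: X = set0.
      by apply/setP => i; rewrite !inE -val_eqE /=; case: ltngtP.
    by rewrite cards0 !subn0 cSi.
  have card2 := etrans cardm Em; split; first by move: card2 X1; lia.
  have /card_gt0P[i0] : (0 < #|X|)%N by move: card2; lia.
  by rewrite inE => /eqP E; exists i0.
have [cS [i0 si0]] := cardS.
pose s (k : 'I_n) : 'I_m := enum_val (cast_ord (esym cS) k).
have sS k : (s k < si (s k))%N.
  by have := enum_valP (cast_ord (esym cS) k); rewrite inE.
have sI : injective s by move=> k l /enum_val_inj /cast_ord_inj.
have s_si k l : (s l == si (s k)) = false.
  apply/eqP => E; have := sS l; rewrite E siK => h.
  by have := ltn_trans h (sS k); rewrite ltnn.
have s_0 k : (s k == i0) = false.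
  by apply/eqP => E; have := sS k; rewrite E si0 ltnn.
have si_0 k : (si (s k) == i0) = false.
  by apply/eqP => E; have := sS k; rewrite -{1}[s k]siK E si0 ltnn.
pose gs k := G (s k) (si (s k)).
have gs0 k : gs k != 0 by apply: siP.
(* The scalars normalise Q(e_k, f_k) and Q(e, e) to 1; only the latter takes a square root. *)
pose D := FrameData (\matrix_k row (s k) V)
  (\matrix_k ((gs k)^-1 *: row (si (s k)) V))
  ((sqrtC (G i0 i0))^-1 *: row i0 V) (\row_k d 0 (s k))
  (\matrix_(k, l) (d 0 (s k) / (d 0 (s k) + d 0 (s l)))).
have scE x (Y : 'M[K]_1) : (x *: Y) 0 0 = x * Y 0 0 by rewrite mxE.
have entry x y i j M : (x *: row i V *m M *m (y *: row j V)^T) 0 0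
    = x * y * (row i V *m M *m (row j V)^T) 0 0.
  by rewrite linearZ /= -scalemxAr -!scalemxAl !scE mulrA [y * x]mulrC.
have lamD k l : d 0 (s k) + d 0 (s l) != 0.
  apply/negP; rewrite addrC addr_eq0 -dsi => /eqP /dI /eqP.
  by rewrite s_si.
have GSS k l : G (s k) (s l) = 0 by apply: G0; rewrite s_si.
have Gii k l : G (si (s k)) (si (s l)) = 0.
  by apply: G0; rewrite siK eq_sym s_si.
have Gsi k l : G (s k) (si (s l)) = gs k *+ (k == l).
  have [->|kl] := eqVneq k l; first by [].
  apply: G0; apply: contraNneq kl => /(can_inj siK) /sI ->; exact: eqxx.
have G_0 k : G (s k) i0 = 0.
  by apply: G0; rewrite -si0 (can_eq siK) eq_sym s_0.
have Gi0 k : G (si (s k)) i0 = 0.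
  by apply: G0; rewrite siK eq_sym s_0.
have g00 : G i0 i0 != 0 by rewrite -{2}si0.
have d0 : d 0 i0 = 0.
  have := dsi i0; rewrite si0 => /eqP.
  by rewrite -addr_eq0 -mulr2n mulrn_eq0 /= => /eqP.
have rowS i : row i V = 1 *: row i V by rewrite scale1r.
have FE_EE : fE D *m Q *m (fE D)^T = 0.
  by apply/matrixP => k l; rewrite bil_entry !rowK GE GSS mxE.
have FE_FF : fF D *m Q *m (fF D)^T = 0.
  by apply/matrixP => k l; rewrite bil_entry !rowK entry GE Gii mulr0 mxE.
have FE_EF : fE D *m Q *m (fF D)^T = 1%:M.
  apply/matrixP => k l; rewrite bil_entry !rowK [row (s k) V]rowS entry GE Gsi.
  rewrite mxE mul1r; have [->|_] := eqVneq k l; last by rewrite mulr0.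
  by rewrite mulr1n mulVf.
have FE_ee : fe D *m Q *m (fe D)^T = 1%:M.
  apply/matrixP => k l; rewrite !ord1 /= entry GE [RHS]mxE eqxx mulr1n.
  rewrite -[X in _ * X](sqrtCK (G i0 i0)) expr2.
  by field; rewrite sqrtC_eq0.
have FE_Ee : fE D *m Q *m (fe D)^T = 0.
  apply/matrixP => k l; rewrite bil_entry rowK row_id [row (s k) V]rowS entry.
  by rewrite GE G_0 mulr0 mxE.
have FE_Fe : fF D *m Q *m (fe D)^T = 0.
  apply/matrixP => k l; rewrite bil_entry rowK row_id entry.
  by rewrite GE Gi0 mulr0 mxE.
have swap p q (A : 'M_(p, m)) (B : 'M_(q, m)) :
    A *m Q *m B^T = (B *m Q *m A^T)^T.
  by rewrite !trmx_mul trmxK sQ mulmxA.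
have FE_FE : fF D *m Q *m (fE D)^T = 1%:M.
  by rewrite swap FE_EF trmx1.
have FE_eE : fe D *m Q *m (fE D)^T = 0.
  by rewrite swap FE_Ee trmx0.
have FE_eF : fe D *m Q *m (fF D)^T = 0.
  by rewrite swap FE_Fe trmx0.
exists D; split; last first.
- by move=> k l kl; rewrite !mxE subr_eq0; apply: contraNneq kl => /dI /sI ->.
- by move=> k l; rewrite !mxE.
split=> //.
(* The Gram relations say H T = 1; the matrices being square, T H = 1, which is the completeness
   relation. *)
- pose H := col_mx (col_mx (fE D) (fF D)) (fe D).
  pose T := row_mx (row_mx (Q *m (fF D)^T) (Q *m (fE D)^T)) (Q *m (fe D)^T).
  have HT : H *m T = 1%:M.
    rewrite mul_col_row !mul_col_mx !mul_mx_row !mulmxA.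
    rewrite FE_EE FE_FF FE_EF FE_ee FE_Ee FE_Fe FE_FE FE_eE FE_eF.
    rewrite col_mx0 row_mx0 -[col_mx _ _]/(block_mx 1%:M 0 0 1%:M).
    by rewrite -scalar_mx_block; apply/esym/scalar_mx_block.
  have : T *m H = 1%:M by apply: mulmx1C_eq HT; lia.
  by rewrite !mul_row_col.
- by apply/matrixP => k l; rewrite bil_entry !rowK WE GSS mulr0 mxE.
- by apply/matrixP => k l; rewrite bil_entry !rowK entry WE Gii !mulr0 mxE.
- apply/matrixP => k l; rewrite bil_entry !rowK [row (s k) V]rowS entry WE Gsi.
  rewrite !mxE mul1r; have [->|_] := eqVneq k l; last by rewrite !mulr0.
  by rewrite !mulr1n mulrCA mulVf // mulr1.
- apply/matrixP => k l; rewrite bil_entry rowK row_id [row (s k) V]rowS entry.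
  by rewrite WE G_0 !mulr0 mxE.
- apply/matrixP => k l; rewrite bil_entry rowK row_id entry.
  by rewrite WE Gi0 !mulr0 mxE.
- by apply/matrixP => k l; rewrite !ord1 /= entry WE d0 mul0r mulr0 mxE.
- by move=> k l; rewrite !mxE; apply/invertible_field.
- by move=> k l; rewrite !mxE mulfVK.
Qed.
End GeneralForm.

(** * Openness of the condition, and the conclusion *)

Section Main.
Variable K : numClosedFieldType.

(** The discriminant of w Q^-1 for the generic matrix w, whose entries are the variables in the
    order of [mxvec]. *)
Definition disc_mpoly m (Q : 'M[K]_m.+1) : {mpoly K[m.+1 * m.+1]} :=
  disc_mx ((\matrix_(i, j) 'X_(mxvec_index i j)) *m map_mx (@mpolyC _ K) (invmx Q)).

Lemma disc_mpolyE m (Q w : 'M[K]_m.+1) :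
  mxeval (disc_mpoly Q) w = disc_mx (w *m invmx Q).
Proof.
rewrite /mxeval /disc_mpoly (map_disc_mx (meval (fun i => mxvec w 0 i))).
rewrite map_mxM -map_mx_comp.
have -> : map_mx (meval (fun i => mxvec w 0 i))
    (\matrix_(i, j) 'X_(mxvec_index i j)) = w.
  by apply/matrixP => i j; rewrite !mxE mevalXU mxvecE.
by rewrite (map_mx_id_in (f := _)) // => i j; rewrite /= mevalC.
Qed.

(** The size is a variable with an equation because polynomials are evaluated at matrices of size
    [m.+1], and [2 * n + 1] is not convertible to a successor. *)
Lemma general_frame n m (Q : 'M[K]_m) : m = (2 * n + 1)%N ->
  Q^T = Q -> Q \in unitmx -> for_general_skew (fun w : 'M[K]_m =>
  exists D : frame_data K n m, [/\ is_frame Q w D,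
    forall i j, flam D 0 i + flam D 0 j != 0
  & forall i j, i != j -> flam D 0 i - flam D 0 j != 0]).
Proof.
case: m Q => [|m] Q Em sQ uQ; first by exfalso; lia.
exists (fun F => F = disc_mpoly Q); split.
  have [w sw sep] := exists_separable Em sQ uQ.
  exists w; split=> //; exists (disc_mpoly Q); split=> //.
  by rewrite disc_mpolyE; apply/eqP/disc_mx_separable.
move=> w [sw [_ [->]]]; rewrite disc_mpolyE => /eqP/disc_mx_separable.
move=> /separable_diagonalizable[V uV [d dI Vd]].
apply: (eigenbasis_frame Em sQ uQ sw uV _ dI).
by rewrite -Vd mulmxA mulmxKV.
Qed.
End Main.

Theorem proposition33 (R : realType) (n : nat) (n_gt0 : (1 <= n)%N)
    (Q : 'M[R[i]]_(2 * n + 1)) (Q_sym : Q^T = Q) (Q_nondeg : Q \in unitmx) :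
  for_general_skew (fun w : 'M[R[i]]_(2 * n + 1) =>
    isomorphic (zero_locus Q w) (power (P1 R[i]) n)).
Proof.
have [I [exU PU]] := general_frame (erefl (2 * n + 1)%N) Q_sym Q_nondeg.
exists I; split=> // w /PU[D [frD lamD lamB]].
by apply: (zero_locus_isomorphic lamD lamB _ frD); rewrite pnatr_eq0.
Qed.
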